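(* For any directed graph $E$ and any field $K$, the following are equivalent: (1) each ideal of $L_K(E)$ is an annihilator ideal; (2) $E$ is strongly all-reflexive; (3) the lattice of ideals of $L_K(E)$ is a Boolean algebra.
   Context: $L_K(E)$ is the Leavitt path algebra of $E$ over $K$. For an ideal $I$, $\operatorname{ann}(I)=\{r\mid rI=Ir=0\}$; $I$ is an annihilator ideal if $\operatorname{ann}(\operatorname{ann}(I))=I$. $E$ is all-reflexive if: (a) each cycle is either without exits or extreme; (b) each vertex emitting infinitely many edges lies on a cycle; (c) for every infinite path $\alpha$ with vertex set $\alpha^0$, only finitely many edges $e$ satisfy $\mathbf{s}(e)\in\alpha^0$ and $\mathbf{r}(e)\notin R(\alpha^0)$. $E$ is strongly all-reflexive if it is all-reflexive and has no cycle without exits. Here a cycle is a closed path of positive length whose edges have distinct sources; an exit is an edge with source on the cycle not on it; a cycle $c$ is extreme if it has exits and for every path $p$ with $\mathbf{s}(p)\in c^0$ there is a path from $\mathbf{r}(p)$ to a vertex of $c$; $R(V)=\{u\mid$ there is a path (possibly of length 0) from $u$ to some $v\in V\}$. *)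

(* Defs.v *)
From HB Require Import structures.
From mathcomp Require Import all_boot all_algebra.
From Stdlib Require Lists.List.
Set Implicit Arguments. Unset Strict Implicit. Unset Printing Implicit Defensive.
Import GRing.Theory.
Local Open Scope ring_scope.

Record graph := Graph {
  vert : Type;
  edge : Type;
  src : edge -> vert;
  rng : edge -> vert }.

Section Graphs.
Variable E : graph.

Fixpoint is_path (p : list (edge E)) : Prop :=
  match p with
  | e :: ((f :: _) as q) => rng e = src f /\ is_path q
  | _ => True
  end.

Definition reaches (u w : vert E) : Prop :=
  u = w \/ exists (e : edge E) (p : list (edge E)),
    is_path (e :: p) /\ src e = u /\ rng (last e p) = w.

Definition is_cycle (c : list (edge E)) : Prop :=
  exists (e : edge E) (p : list (edge E)),
    c = e :: p /\ is_path c /\ rng (last e p) = src e /\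
    List.NoDup (map (@src E) c).

Definition on_cycle (c : list (edge E)) (v : vert E) : Prop :=
  List.In v (map (@src E) c).

Definition is_exit (c : list (edge E)) (f : edge E) : Prop :=
  on_cycle c (src f) /\ ~ List.In f c.

Definition has_exit (c : list (edge E)) : Prop := exists f, is_exit c f.

Definition extreme_cycle (c : list (edge E)) : Prop :=
  has_exit c /\
  forall (e : edge E) (p : list (edge E)),
    is_path (e :: p) -> on_cycle c (src e) ->
    exists w, on_cycle c w /\ reaches (rng (last e p)) w.

Definition infinite_emitter (v : vert E) : Prop :=
  ~ exists l : list (edge E), forall f, src f = v -> List.In f l.

Definition infinite_path (a : nat -> edge E) : Prop :=
  forall n, rng (a n) = src (a n.+1).

Definition ipath_vert (a : nat -> edge E) (v : vert E) : Prop :=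
  exists n, src (a n) = v.

Definition Rset (V : vert E -> Prop) (u : vert E) : Prop :=
  exists w, V w /\ reaches u w.

Definition all_reflexive : Prop :=
  (forall c, is_cycle c -> ~ has_exit c \/ extreme_cycle c) /\
  (forall v, infinite_emitter v -> exists c, is_cycle c /\ on_cycle c v) /\
  (forall a, infinite_path a ->
     exists l : list (edge E), forall f,
       ipath_vert a (src f) -> ~ Rset (ipath_vert a) (rng f) -> List.In f l).

Definition strongly_all_reflexive : Prop :=
  all_reflexive /\ (forall c, is_cycle c -> has_exit c).

End Graphs.

Record nuAlg (K : fieldType) := NuAlg {
  nucar :> lmodType K;
  numul : nucar -> nucar -> nucar;
  numulA : forall x y z, numul x (numul y z) = numul (numul x y) z;
  numulDl : forall x y z, numul (x + y) z = numul x z + numul y z;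
  numulDr : forall x y z, numul x (y + z) = numul x y + numul x z;
  numulZl : forall (k : K) x y, numul (k *: x) y = k *: numul x y;
  numulZr : forall (k : K) x y, numul x (k *: y) = k *: numul x y }.

Arguments numul {K} n _ _.

Section Algebras.
Variable K : fieldType.

Definition alg_hom (A B : nuAlg K) (f : A -> B) : Prop :=
  (forall x y, f (x + y) = f x + f y) /\
  (forall (k : K) x, f (k *: x) = k *: f x) /\
  (forall x y, f (numul A x y) = numul B (f x) (f y)).

Definition leavitt_family (E : graph) (B : nuAlg K)
    (pv : vert E -> B) (pe pes : edge E -> B) : Prop :=
  (forall v, numul B (pv v) (pv v) = pv v) /\
  (forall v w, v <> w -> numul B (pv v) (pv w) = 0) /\
  (forall e, numul B (pv (src e)) (pe e) = pe e /\ numul B (pe e) (pv (rng e)) = pe e) /\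
  (forall e, numul B (pv (rng e)) (pes e) = pes e /\ numul B (pes e) (pv (src e)) = pes e) /\
  (forall e, numul B (pes e) (pe e) = pv (rng e)) /\
  (forall e f, e <> f -> numul B (pes e) (pe f) = 0) /\
  (forall v (l : list (edge E)), List.NoDup l ->
     (forall f, List.In f l <-> src f = v) -> l <> nil ->
     pv v = \sum_(f <- l) numul B (pe f) (pes f)).

Definition is_leavitt_path_algebra (E : graph) (A : nuAlg K)
    (pv : vert E -> A) (pe pes : edge E -> A) : Prop :=
  leavitt_family pv pe pes /\
  forall (B : nuAlg K) (qv : vert E -> B) (qe qes : edge E -> B),
    leavitt_family qv qe qes ->
    exists f : A -> B,
      alg_hom f /\ (forall v, f (pv v) = qv v) /\
      (forall e, f (pe e) = qe e) /\ (forall e, f (pes e) = qes e) /\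
      (forall g : A -> B, alg_hom g -> (forall v, g (pv v) = qv v) ->
         (forall e, g (pe e) = qe e) -> (forall e, g (pes e) = qes e) ->
         forall x, g x = f x).

Variable A : nuAlg K.

Definition ideal (I : A -> Prop) : Prop :=
  I 0 /\ (forall x y, I x -> I y -> I (x - y)) /\
  (forall r x, I x -> I (numul A r x) /\ I (numul A x r)).

Definition seteq (I J : A -> Prop) : Prop := forall x, I x <-> J x.

Definition ann (I : A -> Prop) : A -> Prop :=
  fun r => forall x, I x -> numul A r x = 0 /\ numul A x r = 0.

Definition annihilator_ideal (I : A -> Prop) : Prop := seteq (ann (ann I)) I.

Definition iinter (I J : A -> Prop) : A -> Prop := fun x => I x /\ J x.
Definition isum (I J : A -> Prop) : A -> Prop :=
  fun x => exists a b, I a /\ J b /\ x = a + b.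
Definition izero : A -> Prop := fun x => x = 0.
Definition ifull : A -> Prop := fun _ => True.

Definition ideal_lattice_boolean : Prop :=
  (forall I J L, ideal I -> ideal J -> ideal L ->
     seteq (iinter I (isum J L)) (isum (iinter I J) (iinter I L))) /\
  (forall I, ideal I -> exists J, ideal J /\
     seteq (iinter I J) izero /\ seteq (isum I J) ifull).

End Algebras.

(* Main.v *)
(* Idea. (1) => (2) => (3) => (1).

   (3) => (1): if [A = I + J] is a direct sum of ideals then, as [A] has local units, the
   annihilator of [I] is [J] and conversely.

   (2) => (3): for an ideal [I], let [H] be the set of vertices in [I] and [H'] the set of
   vertices that do not reach [H]; the complement of [I] is the ideal [J] spanned by the
   monomials [p q^*] ending in [H']. The vertices in [I + J] form a hereditary saturated set
   containing [H] and [H'], and condition (c) forces this set to be everything. A nonzero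
   element of [J] can be reduced, by multiplication on both sides, to a vertex of [H'] (every
   cycle has an exit); hence [I] meets [J] trivially.

   (1) => (2): for hereditary [H], the span [I] of the monomials ending in [H] satisfies
   [I + ann I = A]. Splitting a vertex [v] accordingly gives finitely many paths from [v] to [H]
   such that each path from [v] to [H] is comparable to one of them, which fails if [E] violates
   one of the three conditions. If [c] is a cycle at [v] without exits, the action of [A] on
   functions on infinite paths identifies [v] and [c]; the kernel [I] contains [v - c], and the
   grading shows that an element fixed by multiplication by [c] vanishes, so [v] annihilates
   [ann I] and lies in [I]; yet [v] acts nontrivially. *)

From HB Require Import structures.
From mathcomp Require Import all_boot all_algebra.
From mathcomp Require Import boolp functions.
From mathcomp Require Import zify.
Require Import Defs.
Set Implicit Arguments. Unset Strict Implicit. Unset Printing Implicit Defensive.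
Import GRing.Theory.
Local Open Scope ring_scope.

Local Notation "x ** y" := (numul _ x y) (at level 40, left associativity).

(** * Subalgebras *)

Section SubAlgebra.
Variables (K : fieldType) (V : lmodType K) (mul : V -> V -> V) (S : V -> Prop).
Hypothesis S0 : S 0.
Hypothesis SP : forall (k : K) x y, S x -> S y -> S (k *: x + y).
Hypothesis SM : forall x y, S x -> S y -> S (mul x y).
Hypothesis mulA : forall x y z, mul x (mul y z) = mul (mul x y) z.
Hypothesis mulDl : forall x y z, mul (x + y) z = mul x z + mul y z.
(** Right linearity is required only for left factors in [S]: in the application to endomorphisms,
    [mul] composes arbitrary maps, and only linear ones respect sums of their arguments. *)
Hypothesis mulDr : forall x y z, S x -> mul x (y + z) = mul x y + mul x z.
Hypothesis mulZl : forall (k : K) x y, mul (k *: x) y = k *: mul x y.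
Hypothesis mulZr : forall (k : K) x y, S x -> mul x (k *: y) = k *: mul x y.

Definition sub_pred : {pred V} := fun x => `[< S x >].

Fact sub_pred_closed : submod_closed sub_pred.
Proof.
split=> [|k x y /asboolP Sx /asboolP Sy]; apply/asboolP; [exact: S0 | exact: SP].
Qed.

HB.instance Definition _ := GRing.isSubmodClosed.Build K V sub_pred sub_pred_closed.

Definition sub_car : Type := {x : V | sub_pred x}.
HB.instance Definition _ := SubType.on sub_car.
HB.instance Definition _ := [Choice of sub_car by <:].
HB.instance Definition _ := [SubChoice_isSubLmodule of sub_car by <:].

Lemma sub_carP (x : sub_car) : S (val x).
Proof. exact/asboolP/(valP x). Qed.

Definition sub_in x (Sx : S x) : sub_car := exist _ x (asboolT Sx).

Definition sub_mul (x y : sub_car) : sub_car := sub_in (SM (sub_carP x) (sub_carP y)).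

Program Definition sub_alg : nuAlg K := @NuAlg K sub_car sub_mul _ _ _ _ _.
Next Obligation. exact/val_inj/mulA. Qed.
Next Obligation. exact/val_inj/mulDl. Qed.
Next Obligation. exact/val_inj/mulDr/sub_carP. Qed.
Next Obligation. exact/val_inj/mulZl. Qed.
Next Obligation. exact/val_inj/mulZr/sub_carP. Qed.
End SubAlgebra.

(** * Walks in graphs *)

Lemma In_map (T U : Type) (f : T -> U) (l : seq T) y :
  List.In y (map f l) <-> exists x, f x = y /\ List.In x l.
Proof. exact: List.in_map_iff. Qed.
Arguments In_map {T U f l y}.

Lemma In_split (T : Type) (x : T) (l : seq T) :
  List.In x l -> exists l1 l2, l = l1 ++ x :: l2.
Proof. exact: List.in_split. Qed.
Arguments In_split {T x l}.

Lemma In_cat (T : Type) (x : T) (l1 l2 : seq T) :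
  List.In x (l1 ++ l2) <-> List.In x l1 \/ List.In x l2.
Proof. exact: List.in_app_iff. Qed.
Arguments In_cat {T x l1 l2}.

Lemma In_filter (T : Type) (P : T -> Prop) (l : seq T) x :
  List.In x [seq y <- l | `[< P y >]] <-> List.In x l /\ P x.
Proof.
elim: l => [|y l IHl] /=; first tauto.
case: asboolP => Py /=; rewrite IHl; split.
- by case=> [<-|[]]; tauto.
- by tauto.
- by tauto.
- by case=> -[<-|]; tauto.
Qed.
Arguments In_filter {T P l x}.

Lemma list_not_NoDup (T U : Type) (f : T -> U) (l : seq T) :
  ~ List.NoDup (map f l) ->
  exists l1 x l2 y l3, l = l1 ++ x :: l2 ++ y :: l3 /\ f x = f y.
Proof.
elim: l => [|x l IHl] /=; first by case; constructor.
move=> nd; have [fxl|nin] := pselect (List.In (f x) (map f l)).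
  have [y [fxy yl]] := In_map.1 fxl.
  have [l2 [l3 lE]] := In_split yl.
  by exists [::], x, l2, y, l3; rewrite lE.
have [|l1 [z [l2 [y [l3 [-> fzy]]]]]] := IHl.
  by move=> nd'; apply: nd; constructor.
by exists (x :: l1), z, l2, y, l3.
Qed.

Arguments list_not_NoDup {T U f l}.

Lemma ex_minimal_size (T : Type) (P : seq T -> Prop) :
  (exists l, P l) -> exists l, P l /\ forall l', P l' -> (size l <= size l')%N.
Proof.
case=> l0 Pl0; have [n] := ubnP (size l0).
elim: n => // n IHn in l0 Pl0 *; rewrite ltnS => le_n.
have [[l' [Pl' lt']]|noP] := pselect (exists l', P l' /\ (size l' < size l0)%N).
  exact: IHn Pl' (leq_trans lt' le_n).
exists l0; split=> // l' Pl'; rewrite leqNgt; apply/negP => lt'.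
by apply: noP; exists l'.
Qed.

Section Walks.
Variable E : graph.
Implicit Types (u v w : vert E) (e f : edge E) (p q c : seq (edge E)).

Fixpoint walk u p w : Prop :=
  if p is e :: p' then src e = u /\ walk (rng e) p' w else u = w.

Lemma walk_cat u p q w :
  walk u (p ++ q) w <-> exists x, walk u p x /\ walk x q w.
Proof.
elim: p u => [|e p IHp] u /=; first by split=> [|[x [->]]] //; exists u.
split=> [[su /IHp[x [px xq]]]|[x [[su px] xq]]]; first by exists x.
by split=> //; apply/IHp; exists x.
Qed.

Lemma walk_trans u p v q w : walk u p v -> walk v q w -> walk u (p ++ q) w.
Proof. by move=> up vq; apply/walk_cat; exists v. Qed.

Lemma walk_end u p w w' : walk u p w -> walk u p w' -> w = w'.
Proof. by elim: p u => [|e p IHp] u /= => [<- <-|[_ h] [_ /(IHp _ h)]]. Qed.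

Lemma walk_path u e p w :
  walk u (e :: p) w <-> is_path (e :: p) /\ src e = u /\ rng (last e p) = w.
Proof.
elim: p e u => [|f p IHp] e u; first by split=> /= [[-> ->]|[_ [-> ->]]].
have -> : walk u [:: e, f & p] w <-> src e = u /\ walk (rng e) (f :: p) w by [].
rewrite IHp /=; split=> [[su [pp [sf rw]]]|[[sf pp] [su rw]]]; by do ?split.
Qed.

Lemma reachesP u w : reaches u w <-> exists p, walk u p w.
Proof.
split=> [[->|[e [p hp]]]|[[|e p] hp]]; first by exists [::].
- by exists (e :: p); apply/walk_path.
- by left.
- by right; exists e, p; apply/walk_path.
Qed.

Lemma reaches_trans u v w : reaches u v -> reaches v w -> reaches u w.
Proof.
move=> /reachesP[p up] /reachesP[q vq].
by apply/reachesP; exists (p ++ q); apply: walk_trans vq.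
Qed.

Lemma reaches_refl u : reaches u u.
Proof. by left. Qed.

Lemma reaches_edge e : reaches (src e) (rng e).
Proof. by apply/reachesP; exists [:: e]. Qed.

Lemma cycleP c : is_cycle c <->
  c <> [::] /\ (exists v, walk v c v) /\ List.NoDup (map (@src E) c).
Proof.
split=> [[e [p [-> [pp [rs nd]]]]]|[]].
  by split=> //; split=> //; exists (src e); apply/walk_path.
case: c => // e p _ [[v /walk_path[pp [su rw]]] nd].
by exists e, p; rewrite rw su.
Qed.

Lemma on_cycle_rot c v : is_cycle c -> on_cycle c v ->
  exists c', c' <> [::] /\ walk v c' v /\ forall e, List.In e c' <-> List.In e c.
Proof.
move=> /cycleP[c0 [[u uc] _]] /In_map[e [<- /In_split[c1 [c2 cE]]]].
move: uc; rewrite cE => /walk_cat[x [uc1 /= [se ec2]]].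
exists (e :: c2 ++ c1); split=> //; split=> [/=|f].
  by split=> //; rewrite -se in uc1; apply: walk_trans ec2 uc1.
by rewrite -cat_cons !In_cat; tauto.
Qed.

(** A shortest nonempty closed walk at [v] has distinct sources: the stretch between two edges with
    equal source could be cut out. *)
Lemma closed_walk_cycle v p : p <> [::] -> walk v p v ->
  exists c, is_cycle c /\ c <> [::] /\ walk v c v.
Proof.
move=> p0 vp; have [|c [[c0 vc] cmin]] :=
    @ex_minimal_size _ (fun c => c <> [::] /\ walk v c v).
  by exists p.
exists c; split=> //; apply/cycleP; split=> //; split; first by exists v.
apply: contrapT => /list_not_NoDup[l1 [x [l2 [y [l3 [cE sxy]]]]]].
move: vc; rewrite cE => /walk_cat[w [vl1 /= [sx]]].
move=> /walk_cat[w' [_ /= [sy yl3]]].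
have: (size c <= size (l1 ++ y :: l3))%N.
  apply: cmin; split; first by case: (l1).
  by apply: walk_trans vl1 _; rewrite /= -sx sxy.
by rewrite cE !size_cat /= size_cat /= leq_add2l !ltnS addnS -addSn leqNgt ltnS leq_addl.
Qed.

Lemma walk_on_cycle v c : c <> [::] -> walk v c v -> on_cycle c v.
Proof. by case: c => //= e c _ [<- _]; left. Qed.

Lemma closed_walk_on_cycle v p : p <> [::] -> walk v p v ->
  exists c, is_cycle c /\ on_cycle c v.
Proof.
move=> p0 /(closed_walk_cycle p0)[c [cc [c0 vc]]].
by exists c; split=> //; apply: walk_on_cycle.
Qed.

Fixpoint cpow c n : seq (edge E) := if n is n'.+1 then c ++ cpow c n' else [::].

Lemma walk_cpow v c n : walk v c v -> walk v (cpow c n) v.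
Proof. by move=> vc; elim: n => //= n; apply: walk_trans. Qed.

Lemma size_cpow c n : size (cpow c n) = (n * size c)%N.
Proof. by elim: n => //= n IHn; rewrite size_cat IHn mulSn. Qed.

Lemma In_cpow e c n : List.In e (cpow c n) -> List.In e c.
Proof. by elim: n => //= n IHn /In_cat[|/IHn]. Qed.

Lemma leq_size_cpow c n : c <> [::] -> (n <= size (cpow c n))%N.
Proof. by rewrite size_cpow => c0; apply: leq_pmulr; case: c c0. Qed.

Definition hereditary (H : vert E -> Prop) := forall e, H (src e) -> H (rng e).

(** The edges at a regular vertex are enumerated exactly as in the last relation of
    [leavitt_family], so that this relation applies directly. *)
Definition saturated (H : vert E -> Prop) :=
  forall v (l : seq (edge E)), List.NoDup l ->
    (forall f, List.In f l <-> src f = v) -> l <> nil ->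
    (forall f, src f = v -> H (rng f)) -> H v.

Lemma hereditary_walk (H : vert E -> Prop) u p w :
  hereditary H -> walk u p w -> H u -> H w.
Proof. by move=> hH; elim: p u => [|e p IHp] u /= => [->|[<- /IHp h] /hH]. Qed.

Lemma hereditary_reaches (H : vert E -> Prop) u w :
  hereditary H -> reaches u w -> H u -> H w.
Proof. by move=> hH /reachesP[p]; apply: hereditary_walk. Qed.

Lemma regular_list v : ~ infinite_emitter v ->
  exists l : seq (edge E), List.NoDup l /\ forall f, List.In f l <-> src f = v.
Proof.
move=> /contrapT[l lP].
exists (List.nodup (fun e f => pselect (e = f)) [seq f <- l | `[< src f = v >]]).
split=> [|f]; first exact: List.NoDup_nodup.
rewrite List.nodup_In In_filter.
by split=> [[]|fv] //; split=> //; exact: lP.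
Qed.

(** Extremality leads from [w] to some vertex of the cycle, and the cycle rotated to start there
    passes through [v]. *)
Lemma extreme_back c v w : is_cycle c -> extreme_cycle c -> on_cycle c v ->
  reaches v w -> reaches w v.
Proof.
move=> cc [_ ext] cv /reachesP[[|e p] /= vw]; first by rewrite vw; left.
have [pp [se re]] := (walk_path v e p w).1 vw.
have [|x [cx]] := ext e p pp; first by rewrite se.
rewrite re => wx; apply: reaches_trans wx _.
have [c' [c'0 [xc' c'P]]] := on_cycle_rot cc cx.
have : List.In v (map (@src E) c').
  by move: cv => /In_map[f [<- fc]]; apply/In_map; exists f; rewrite c'P.
move=> /In_map[f [<- /In_split[l1 [l2 c'E]]]].
move: xc'; rewrite c'E => /walk_cat[y [xl1 /= [-> _]]].
by apply/reachesP; exists l1.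
Qed.

Lemma walk_iota (a : nat -> edge E) n k : infinite_path a ->
  walk (src (a n)) [seq a i | i <- iota n k] (src (a (n + k)%N)).
Proof.
move=> ha; elim: k n => [|k IHk] n /=; first by rewrite addn0.
by split=> //; rewrite ha addnS -addSn; apply: IHk.
Qed.

End Walks.

(** * Hereditary saturated sets in strongly all-reflexive graphs *)

Section Saturation.
Variables (E : graph) (H S : vert E -> Prop).
Hypothesis sarE : strongly_all_reflexive E.
Hypotheses (hH : hereditary H) (hS : hereditary S) (sS : saturated S).
Hypothesis HS : forall v, H v -> S v.
Hypothesis nHS : forall v, (forall w, H w -> ~ reaches v w) -> S v.

Let X v := ~ S v.

Let X_reaches v : X v -> exists w, H w /\ reaches v w.
Proof.
move=> Xv; apply: contrapT => noH; apply: Xv; apply: nHS => w Hw vw.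
by apply: noH; exists w.
Qed.

(** A vertex outside [S] reaches [H]. On a cycle, which has an exit and is therefore extreme, it
    would be reached back from [H] and so lie in [H]. *)
Let X_off_cycle v c : X v -> is_cycle c -> on_cycle c v -> False.
Proof.
move=> Xv cc cv; have [w [Hw vw]] := X_reaches Xv.
have [//|ext] := sarE.1.1 c cc; first by apply; apply: sarE.2.
by apply: Xv; apply: HS; apply: hereditary_reaches (extreme_back cc ext cv vw) Hw.
Qed.

Let X_acyclic v p : X v -> p <> [::] -> walk v p v -> False.
Proof.
by move=> Xv p0 /(closed_walk_on_cycle p0)[c [cc]]; apply: X_off_cycle.
Qed.

(** By condition (b) and [X_off_cycle], [v] emits finitely many edges. It is no sink, as it reaches
    [H] without lying in it, so saturation forbids all its edges to end in [S]. *)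
Let X_edge v : X v -> exists e, src e = v /\ X (rng e).
Proof.
move=> Xv; have [|l [ndl lP]] := @regular_list E v.
  by move=> /sarE.1.2.1[c [cc]]; apply: X_off_cycle.
apply: contrapT => noe; have Srng f : src f = v -> S (rng f).
  by move=> sf; apply: contrapT => Xf; apply: noe; exists f.
have [l0|l0] := pselect (l = [::]); last by apply: Xv; apply: sS ndl lP l0 Srng.
have [w [Hw /reachesP[[|e p] /= [vw]]]] := X_reaches Xv.
  by apply: Xv; rewrite vw; apply: HS.
by move/lP: vw; rewrite l0.
Qed.

Let leaky v := X v /\ exists f, src f = v /\ S (rng f).

Let X_leaky v : X v -> exists p w, walk v p w /\ leaky w.
Proof.
move=> Xv; have [w [/HS Sw /reachesP[p]]] := X_reaches Xv.
elim: p v Xv => [|e p IHp] v Xv /= => [vw|[se pw]]; first by case: Xv; rewrite vw.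
have [Se|Xe] := pselect (S (rng e)).
  by exists [::], v; split=> //; split=> //; exists e.
have [q [x [eq lx]]] := IHp _ Xe pw.
by exists (e :: q), x.
Qed.

(* Steering towards the nearest vertex with an edge into [S] produces an infinite
   path outside [S] that meets infinitely many such vertices. *)
Let X_step : exists m : vert E -> nat, forall v, X v ->
  exists e, src e = v /\ X (rng e) /\ (leaky v \/ (m (rng e) < m v)%N).
Proof.
have /choice[m mP] (v : vert E) : exists n, X v ->
    (exists p w, walk v p w /\ leaky w /\ size p = n) /\
    forall p w, walk v p w -> leaky w -> (n <= size p)%N.
  have [Xv|nXv] := pselect (X v); last by exists 0%N.
  have [p [[w [vp lw]] pmin]] := ex_minimal_size (X_leaky Xv).
  exists (size p) => _; split=> [|q x vq lx]; first by exists p, w.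
  by apply: pmin; exists x.
exists m => v Xv; have [[p [w [vp [lw sp]]]] _] := mP v Xv.
case: p vp sp => [/=|e p /= [se ep] sp].
  move=> vw _; have [e [se Xe]] := X_edge Xv; exists e; split=> //; split=> //.
  by left; rewrite vw.
have Xe : X (rng e).
  by move=> /(hereditary_walk hS ep) Sw; case: lw.
exists e; split=> //; split=> //; right.
by rewrite -sp ltnS; apply: (mP _ Xe).2 ep lw.
Qed.

(** Following [nx] from a vertex outside [S] gives an infinite path without repetitions. Its edges
    into [S] cannot return to it, as [S] is hereditary; there are infinitely many of them, against
    condition (c). *)
Lemma saturation_full v : S v.
Proof.
apply: contrapT => Xv; have [m mP] := X_step; have [e0 _] := X_edge Xv.
have /choice[nx nxP] (u : vert E) : exists e, X u ->
    src e = u /\ X (rng e) /\ (leaky u \/ (m (rng e) < m u)%N).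
  by have [/mP[e eP]|nXu] := pselect (X u); [exists e | exists e0].
pose b n := iter n (fun u => rng (nx u)) v.
have Xb n : X (b n) by elim: n => //= n /nxP[_ []].
pose a n := nx (b n).
have srca n : src (a n) = b n by have [] := nxP _ (Xb n).
have ha : infinite_path a by move=> n; rewrite srca.
(* Along vertices that are not leaky, [m] strictly decreases, so a leaky vertex follows. *)
have leak n : exists k, (n <= k)%N /\ leaky (b k).
  have [j] := ubnP (m (b n)); elim: j => // j IHj in n *; rewrite ltnS => le_j.
  have [_ [_ [lb|lt]]] := nxP _ (Xb n); first by exists n.
  have [|k [le_nk lk]] := IHj n.+1; first exact: leq_trans lt le_j.
  by exists k; split=> //; apply: ltnW.
have binj i j : (i < j)%N -> b i <> b j.
  move=> lt_ij bij; apply: (@X_acyclic (b i) [seq a k | k <- iota i (j - i)]) => //.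
    by rewrite -subn_gt0 in lt_ij; case: (j - i)%N lt_ij.
  rewrite {2}bij -!srca; have := walk_iota i (j - i) ha.
  by rewrite subnKC // ltnW.
have [l lP] := sarE.1.2.2 a ha.
(* Each edge of [l] starts at no more than one position of the path, so beyond some [M] none of them
   starts on it. *)
have [M MP] : exists M, forall f k, List.In f l -> (M <= k)%N -> src f <> b k.
  elim: (l) => [|f l' [M MP]]; first by exists 0%N.
  have [[i fi]|nof] := pselect (exists i, src f = b i).
    exists (maxn M i.+1) => g k [<-|gl]; rewrite geq_max => /andP[leM lei].
      by rewrite fi; apply: binj.
    exact: MP.
  exists M => g k [<-|gl] leM; last exact: MP.
  by move=> fk; apply: nof; exists k.
have [k [leMk [_ [f [sf Sf]]]]] := leak M.
apply: (MP f k) => //; apply: lP; first by exists k; rewrite srca.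
move=> [w [[i <-] fw]]; apply: (Xb i); rewrite -srca.
exact: hereditary_reaches fw Sf.
Qed.

End Saturation.

(** * Ideals *)

Section NuAlgTheory.
Variables (K : fieldType) (A : nuAlg K).
Implicit Types (x y z : A) (I J : A -> Prop).

Lemma nmul0l x : (0 : A) ** x = 0.
Proof. by apply: (addrI (0 ** x)); rewrite -numulDl !addr0. Qed.

Lemma nmul0r x : x ** (0 : A) = 0.
Proof. by apply: (addrI (x ** 0)); rewrite -numulDr !addr0. Qed.

Lemma nmulNl x y : (- x) ** y = - (x ** y).
Proof. by rewrite -scaleN1r numulZl scaleN1r. Qed.

Lemma nmulNr x y : x ** (- y) = - (x ** y).
Proof. by rewrite -scaleN1r numulZr scaleN1r. Qed.

Lemma nmulBl x y z : (x - y) ** z = x ** z - y ** z.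
Proof. by rewrite numulDl nmulNl. Qed.

Lemma nmulBr x y z : x ** (y - z) = x ** y - x ** z.
Proof. by rewrite numulDr nmulNr. Qed.

Lemma nmul_suml (T : Type) (s : seq T) (F : T -> A) y :
  (\sum_(t <- s) F t) ** y = \sum_(t <- s) F t ** y.
Proof. by elim: s => [|t s IHs]; rewrite ?big_nil ?nmul0l // !big_cons numulDl IHs. Qed.

Lemma nmul_sumr (T : Type) (s : seq T) (F : T -> A) y :
  y ** (\sum_(t <- s) F t) = \sum_(t <- s) y ** F t.
Proof. by elim: s => [|t s IHs]; rewrite ?big_nil ?nmul0r // !big_cons numulDr IHs. Qed.

Lemma ideal0 I : ideal I -> I 0. Proof. by case. Qed.

Lemma idealB I x y : ideal I -> I x -> I y -> I (x - y).
Proof. by case=> _ [h _]; apply: h. Qed.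

Lemma idealN I x : ideal I -> I x -> I (- x).
Proof. by move=> hI Ix; rewrite -[- x]sub0r; apply: idealB => //; apply: ideal0. Qed.

Lemma idealD I x y : ideal I -> I x -> I y -> I (x + y).
Proof. by move=> hI Ix Iy; rewrite -[y]opprK; apply: idealB => //; apply: idealN. Qed.

Lemma ideal_mull I r x : ideal I -> I x -> I (r ** x).
Proof. by case=> _ [_ h] /(h r)[]. Qed.

Lemma ideal_mulr I r x : ideal I -> I x -> I (x ** r).
Proof. by case=> _ [_ h] /(h r)[]. Qed.

Lemma ideal_sum I (T : Type) (s : seq T) (F : T -> A) :
  ideal I -> (forall t, List.In t s -> I (F t)) -> I (\sum_(t <- s) F t).
Proof.
move=> hI; elim: s => [|t s IHs] h; first by rewrite big_nil; apply: ideal0.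
rewrite big_cons; apply: idealD => //; first by apply: h; left.
by apply: IHs => t' ts; apply: h; right.
Qed.

Lemma isum_ideal I J : ideal I -> ideal J -> ideal (isum I J).
Proof.
move=> hI hJ; split; first by exists 0, 0; rewrite addr0; do !split; apply: ideal0.
split=> [x y [a [b [Ia [Jb ->]]]] [a' [b' [Ia' [Jb' ->]]]]|r x [a [b [Ia [Jb ->]]]]].
  exists (a - a'), (b - b'); do !split; try exact: idealB.
  by rewrite opprD addrACA.
split; [exists (r ** a), (r ** b) | exists (a ** r), (b ** r)];
  rewrite ?numulDr ?numulDl; do !split => //;
  by [apply: ideal_mull | apply: ideal_mulr].
Qed.

Lemma ann_ideal I : ideal I -> ideal (ann I).
Proof.
move=> hI; split=> [x _|]; first by rewrite nmul0l nmul0r.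
split=> [x y hx hy z Iz|r x hx].
  have [xz zx] := hx z Iz; have [yz zy] := hy z Iz.
  by rewrite nmulBl nmulBr xz zx yz zy subr0.
split=> z Iz.
  by rewrite -numulA (hx z Iz).1 nmul0r numulA (hx _ (ideal_mulr r hI Iz)).2.
by rewrite -numulA (hx _ (ideal_mull r hI Iz)).1 numulA (hx z Iz).2 nmul0l.
Qed.

Lemma isuml I J x : ideal J -> I x -> isum I J x.
Proof. by move=> hJ Ix; exists x, 0; rewrite addr0; do !split => //; apply: ideal0. Qed.

Lemma isumr I J x : ideal I -> J x -> isum I J x.
Proof. by move=> hI Jx; exists 0, x; rewrite add0r; do !split => //; apply: ideal0. Qed.

Definition local_units := forall x, exists u, u ** x = x /\ x ** u = x.

Lemma boolean_annihilator :
  local_units -> ideal_lattice_boolean A -> forall I, ideal I -> annihilator_ideal I.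
Proof.
move=> lu [_ compl] I hI; have [J [hJ [IJ0 IJ1]]] := compl I hI.
have IJ a b : I a -> J b -> a ** b = 0 /\ b ** a = 0.
  move=> Ia Jb; split; apply/IJ0; split;
    by [apply: ideal_mull | apply: ideal_mulr].
(* Write [x = p + q]. From [x P = 0] and [q P = 0] follows [p P = 0]; splitting a local unit of [p]
   along [P + Q] then gives [p = 0]. Both inclusions use this, with [I] and [J] exchanged. *)
have half (P Q : A -> Prop) : ideal P -> ideal Q -> (forall x, isum P Q x) ->
    (forall a b, P a -> Q b -> a ** b = 0 /\ b ** a = 0) ->
    forall x, ann P x -> Q x.
  move=> hP hQ PQ1 PQ0 x annx; have [p [q [Pp [Qq xE]]]] := PQ1 x.
  suff p0 : p = 0 by rewrite xE p0 add0r.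
  have [u [_ <-]] := lu p; have [p' [q' [Pp' [Qq' ->]]]] := PQ1 u.
  rewrite numulDr (PQ0 _ _ Pp Qq').1 addr0.
  by have := (annx p' Pp').1; rewrite xE numulDl (PQ0 _ _ Pp' Qq).2 addr0.
move=> x; split=> [annx|Ix y anny]; last first.
  have Jy : J y by apply: half anny => // z; apply/IJ1.
  by have [-> ->] := IJ _ _ Ix Jy.
apply: (half J I) => // [z|a b Ja Ib|y Jy].
- have /IJ1[a [b [Ia [Jb ->]]]] : ifull z by [].
  by exists b, a; rewrite addrC.
- by have [-> ->] := IJ _ _ Ib Ja.
- by apply: annx => z Iz; have [-> ->] := IJ _ _ Iz Jy.
Qed.

(* With [u = i + j] a local unit of [x] split along [A = I + I'], one has [x = i x]. *)
Lemma complemented_distributive I I' J L : local_units ->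
  ideal I -> ideal I' -> ideal J -> ideal L ->
  seteq (iinter I I') (@izero K A) -> (forall x, isum I I' x) ->
  seteq (iinter I (isum J L)) (isum (iinter I J) (iinter I L)).
Proof.
move=> lu hI hI' hJ hL II'0 II'1 x; split; last first.
  move=> [a [b [[Ia Ja] [[Ib Lb] ->]]]]; split; first exact: idealD.
  by exists a, b.
move=> [Ix [a [b [Ja [Lb xE]]]]].
have [u [ux _]] := lu x; have [i [j [Ii [I'j uE]]]] := II'1 u.
have jx : j ** x = 0.
  by apply/II'0; split; [apply: ideal_mull | apply: ideal_mulr].
exists (i ** a), (i ** b); split; first by split; [apply: ideal_mulr | apply: ideal_mull].
split; first by split; [apply: ideal_mulr | apply: ideal_mull].
by rewrite -numulDr -xE -[LHS]ux uE numulDl jx addr0.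
Qed.

End NuAlgTheory.

(** * Monomials *)

Definition comparable_words (T : Type) (p q : seq T) := exists t, p = q ++ t \/ q = p ++ t.

Section Monomials.
Variables (E : graph) (K : fieldType) (A : nuAlg K).
Variables (pv : vert E -> A) (pe pes : edge E -> A).
Hypothesis LF : leavitt_family pv pe pes.
Implicit Types (u v w : vert E) (e f : edge E) (p q : seq (edge E)).

Lemma pvv v : pv v ** pv v = pv v. Proof. by have [h _] := LF. Qed.
Lemma pvw0 v w : v <> w -> pv v ** pv w = 0. Proof. by have [_ [h _]] := LF; apply: h. Qed.
Lemma pve e : pv (src e) ** pe e = pe e. Proof. by have [_ [_ [h _]]] := LF; case: (h e). Qed.
Lemma pev e : pe e ** pv (rng e) = pe e. Proof. by have [_ [_ [h _]]] := LF; case: (h e). Qed.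
Lemma pvs e : pv (rng e) ** pes e = pes e.
Proof. by have [_ [_ [_ [h _]]]] := LF; case: (h e). Qed.
Lemma psv e : pes e ** pv (src e) = pes e.
Proof. by have [_ [_ [_ [h _]]]] := LF; case: (h e). Qed.
Lemma pse e : pes e ** pe e = pv (rng e).
Proof. by have [_ [_ [_ [_ [h _]]]]] := LF. Qed.
Lemma psf0 e f : e <> f -> pes e ** pe f = 0.
Proof. by have [_ [_ [_ [_ [_ [h _]]]]]] := LF; apply: h. Qed.
Lemma ck2 v (l : seq (edge E)) : List.NoDup l -> (forall f, List.In f l <-> src f = v) ->
  l <> nil -> pv v = \sum_(f <- l) pe f ** pes f.
Proof. by have [_ [_ [_ [_ [_ [_ h]]]]]] := LF; apply: h. Qed.

Lemma vertices_hereditary (I : A -> Prop) : ideal I -> hereditary (fun v => I (pv v)).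
Proof. by move=> hI e Ie; rewrite -pse -pve; apply: ideal_mull => //; apply: ideal_mulr. Qed.

Lemma vertices_saturated (I : A -> Prop) : ideal I -> saturated (fun v => I (pv v)).
Proof.
move=> hI v l ndl lP l0 Iv; rewrite (ck2 ndl lP l0); apply: ideal_sum => // f /lP fv.
by rewrite -pev; apply: ideal_mulr => //; apply: ideal_mull => //; apply: Iv.
Qed.

(** The end vertex is an explicit argument of the elements below, because an empty list does not
    determine it. For paths ending at [w], [path_elt w p] is [p], [star_elt w q] is [q^*] and
    [mono p w q] is [p q^*]. *)
Definition lmul_path p (x : A) : A := foldr (fun e y => pe e ** y) x p.
Definition rmul_star q (x : A) : A := foldr (fun e y => y ** pes e) x q.
Definition path_elt w p : A := lmul_path p (pv w).
Definition star_elt w q : A := rmul_star q (pv w).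
Definition mono p w q : A := path_elt w p ** star_elt w q.

Arguments path_elt : simpl never.
Arguments star_elt : simpl never.

Lemma lmul_path_mul p x y : lmul_path p x ** y = lmul_path p (x ** y).
Proof. by elim: p => //= e p IHp; rewrite -numulA IHp. Qed.

Lemma rmul_star_mul q x y : y ** rmul_star q x = rmul_star q (y ** x).
Proof. by elim: q => //= e q IHq; rewrite numulA IHq. Qed.

Lemma path_elt_cons w e p : path_elt w (e :: p) = pe e ** path_elt w p.
Proof. by []. Qed.

Lemma star_elt_cons w e q : star_elt w (e :: q) = star_elt w q ** pes e.
Proof. by []. Qed.

Lemma pv_path u p w : walk u p w -> pv u ** path_elt w p = path_elt w p.
Proof.
case: p => [/= ->|e p /= [<- _]]; first by rewrite /path_elt /= pvv.
by rewrite path_elt_cons numulA pve.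
Qed.

Lemma path_pv w p : path_elt w p ** pv w = path_elt w p.
Proof. by rewrite /path_elt lmul_path_mul pvv. Qed.

Lemma star_pv u q w : walk u q w -> star_elt w q ** pv u = star_elt w q.
Proof.
case: q => [/= ->|e q /= [<- _]]; first by rewrite /star_elt /= pvv.
by rewrite star_elt_cons -numulA psv.
Qed.

Lemma pv_star w q : pv w ** star_elt w q = star_elt w q.
Proof. by rewrite /star_elt rmul_star_mul pvv. Qed.

Lemma pv_path0 u v p w : walk u p w -> v <> u -> pv v ** path_elt w p = 0.
Proof. by move=> up vu; rewrite -(pv_path up) numulA pvw0 // nmul0l. Qed.

Lemma star_pv0 u v p w : walk u p w -> v <> u -> star_elt w p ** pv v = 0.
Proof. by move=> up vu; rewrite -(star_pv up) -numulA pvw0 ?nmul0r // => h; apply: vu. Qed.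

Lemma path_cat w p w' t : walk w t w' ->
  path_elt w p ** path_elt w' t = path_elt w' (p ++ t).
Proof.
move=> wt; rewrite {1}/path_elt lmul_path_mul pv_path //.
by rewrite /path_elt /lmul_path foldr_cat.
Qed.

Lemma star_cat w q w' t : walk w t w' ->
  star_elt w' t ** star_elt w q = star_elt w' (q ++ t).
Proof.
move=> wt; rewrite {2}/star_elt rmul_star_mul star_pv //.
by rewrite /star_elt /rmul_star foldr_cat.
Qed.

Lemma star_path u q w : walk u q w -> star_elt w q ** path_elt w q = pv w.
Proof.
elim: q u => [|e q IHq] u /=; first by rewrite /star_elt /path_elt /= pvv.
move=> [_ eq]; rewrite star_elt_cons path_elt_cons -numulA [pes e ** _]numulA pse.
by rewrite pv_path // (IHq _ eq).
Qed.

Lemma star_path_cat u q w t w' : walk u q w -> walk w t w' ->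
  star_elt w q ** path_elt w' (q ++ t) = path_elt w' t.
Proof. by move=> uq wt; rewrite -(path_cat q wt) numulA (star_path uq) pv_path. Qed.

Lemma star_cat_path u q w t w' : walk u q w -> walk w t w' ->
  star_elt w' (q ++ t) ** path_elt w q = star_elt w' t.
Proof. by move=> uq wt; rewrite -(star_cat q wt) -numulA (star_path uq) star_pv. Qed.

(** Equal first edges cancel until two letters differ, where [psf0] applies. Since the words need
    not be paths, two consecutive edges that do not compose are treated separately: there
    orthogonality of vertices gives zero. *)
Lemma star_path0 w q w' p : ~ comparable_words q p -> star_elt w q ** path_elt w' p = 0.
Proof.
elim: q p => [|e q IHq] [|f p] npq; try by [case: npq; exists (f :: p); right
  | case: npq; exists [::]; left | case: npq; exists (e :: q); left].
rewrite star_elt_cons path_elt_cons -numulA [pes e ** _]numulA.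
have [ef|ef] := pselect (e = f); last by rewrite psf0 // nmul0l nmul0r.
rewrite -ef in npq *; rewrite pse.
have {}npq : ~ comparable_words q p.
  by move=> [t [h|h]]; apply: npq; exists t; rewrite h; [left | right].
case: p npq => [|g p] npq; first by case: npq; exists q; left.
have [re|re] := pselect (rng e = src g); last first.
  by rewrite path_elt_cons -pve ![pv (rng e) ** _]numulA pvw0 // !nmul0l nmul0r.
by rewrite re path_elt_cons [pv _ ** _]numulA pve -path_elt_cons IHq.
Qed.

Record term := Term {tk : K; tp : seq (edge E); tw : vert E; tq : seq (edge E)}.

Definition tval (t : term) : A := tk t *: mono (tp t) (tw t) (tq t).

(** An explicit list of terms records data, such as the lengths of ghost paths, that the element
    alone does not determine. *)
Definition lin (G : term -> Prop) (x : A) :=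
  exists l : seq term, (forall t, List.In t l -> G t) /\ x = \sum_(t <- l) tval t.

Lemma lin0 G : lin G 0.
Proof. by exists [::]; rewrite big_nil. Qed.

Lemma linD G x y : lin G x -> lin G y -> lin G (x + y).
Proof.
move=> [l [lG ->]] [l' [l'G ->]]; exists (l ++ l'); rewrite big_cat; split=> //.
by move=> t /In_cat[/lG|/l'G].
Qed.

Lemma lin_ind (G : term -> Prop) (P : A -> Prop) :
  P 0 -> (forall t x, G t -> P x -> P (tval t + x)) -> forall x, lin G x -> P x.
Proof.
move=> P0 PS x [l [lG ->]]; elim: l lG => [|t l IHl] lG; first by rewrite big_nil.
rewrite big_cons; apply: PS; first by apply: lG; left.
by apply: IHl => t' tl; apply: lG; right.
Qed.

Lemma lin_term (G : term -> Prop) k p w q :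
  G (Term k p w q) -> lin G (k *: mono p w q).
Proof. by move=> Gt; exists [:: Term k p w q]; rewrite big_seq1; split=> // t [<-|[]]. Qed.

Lemma lin_map (G G' : term -> Prop) (h : A -> A) :
  h 0 = 0 -> (forall x y, h (x + y) = h x + h y) ->
  (forall t, G t -> lin G' (h (tval t))) -> forall x, lin G x -> lin G' (h x).
Proof.
move=> h0 hD ht; apply: lin_ind => [|t x Gt lx]; first by rewrite h0; apply: lin0.
by rewrite hD; apply: linD => //; apply: ht.
Qed.

Lemma lin_mono (G G' : term -> Prop) x : (forall t, G t -> G' t) -> lin G x -> lin G' x.
Proof. by move=> GG' [l [lG xE]]; exists l; split=> // t /lG/GG'. Qed.

Definition term_into (H : vert E -> Prop) (t : term) :=
  [/\ H (tw t), exists u, walk u (tp t) (tw t) & exists u, walk u (tq t) (tw t)].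

Definition span H := lin (term_into H).

Lemma linZ H k x : span H x -> span H (k *: x).
Proof.
apply: lin_map => [|{}x y|t Gt]; first by rewrite scaler0.
  by rewrite scalerDr.
by rewrite /tval scalerA; apply: lin_term.
Qed.

Lemma span_pv H v : H v -> span H (pv v).
Proof.
move=> Hv; have := @lin_term (term_into H) 1 [::] v [::].
rewrite scale1r /mono /path_elt /star_elt /= pvv; apply.
by split=> //; exists v.
Qed.

Lemma path_nil w : path_elt w [::] = pv w. Proof. by []. Qed.
Lemma star_nil w : star_elt w [::] = pv w. Proof. by []. Qed.

Lemma tval_pe t e u : term_into (fun=> True) t -> walk u (tq t) (tw t) ->
  tval t ** pe e = if tq t is f :: q' then
      if `[< e = f >] then tval (Term (tk t) (tp t) (tw t) q') else 0
    else if `[< src e = tw t >] then tval (Term (tk t) (rcons (tp t) e) (rng e) [::]) else 0.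
Proof.
case: t => k p w [|f q] _ /= uq; rewrite /tval /mono numulZl -numulA /=.
  case: asboolP => [sw|sw].
    by rewrite -sw !star_nil pve path_pv -cats1 -(@path_cat (src e)) //= path_elt_cons path_nil pev.
  by rewrite star_nil -pve [pv w ** _]numulA pvw0 ?nmul0l ?nmul0r ?scaler0 // => h; apply: sw.
rewrite star_elt_cons -numulA; case: asboolP => [->|ef]; last first.
  by rewrite psf0 ?nmul0r ?scaler0 // => h; apply: ef.
by case: uq => _ uq; rewrite pse (star_pv uq).
Qed.

Definition short_term_into H n (t : term) := term_into H t /\ (size (tq t) <= n)%N.

Lemma span_small H x : span H x -> exists n, lin (short_term_into H n) x.
Proof.
elim/lin_ind: x / => [|[k p w q] x Ht [n lx]]; first by exists 0%N; apply: lin0.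
exists (maxn n (size q)); apply: linD; first by apply: lin_term; rewrite /short_term_into leq_maxr.
by apply: lin_mono lx => t [gt st]; split=> //; rewrite leq_max st.
Qed.

(** An edge on the right cancels the first edge of a ghost path or kills the term. If the ghost path
    is empty, the real path is extended instead, and heredity keeps its end in [H]. *)
Lemma small_pe H n e x : hereditary H -> lin (short_term_into H n) x ->
  lin (short_term_into H n.-1) (x ** pe e).
Proof.
move=> hH; apply: (lin_map (h := fun x => x ** pe e)) => [|{}x y|t [[Ht [u' up] [u uq]]]].
- exact: nmul0l.
- exact: numulDl.
rewrite (tval_pe _ (u := u)) //; last by split=> //; [exists u' | exists u].
case: t Ht up uq => k p w [|f q] /= Hw up uq sq; last first.
  case: asboolP => _; last exact: lin0.
  case: uq => _ uq; apply: lin_term; split; last by case: n sq.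
  by split=> //; [exists u' | exists (rng f)].
case: asboolP => [sw|_]; last exact: lin0.
rewrite -cats1; apply: lin_term; split=> //; split=> /=; first by apply: hH; rewrite sw.
  by exists u'; apply/walk_cat; exists w.
by exists (rng e).
Qed.

Lemma span_pe H e x : hereditary H -> span H x -> span H (x ** pe e).
Proof.
by move=> hH /span_small[n /(small_pe e hH)]; apply: lin_mono => t [].
Qed.

Lemma span_pes H e x : span H x -> span H (x ** pes e).
Proof.
apply: (lin_map (h := fun x => x ** pes e)) => [|{}x y|[k p w q] [/= Hw [u' up] [u uq]]].
- exact: nmul0l.
- exact: numulDl.
rewrite /tval /mono numulZl -numulA /=.
have [re|re] := pselect (rng e = u); last first.
  rewrite -pvs [star_elt _ _ ** _]numulA (star_pv0 uq) // nmul0l nmul0r scaler0.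
  exact: lin0.
rewrite -star_elt_cons; apply: lin_term; split=> //=; first by exists u'.
by exists (src e); rewrite re.
Qed.

Lemma span_mulv H v x : span H x -> span H (x ** pv v).
Proof.
apply: (lin_map (h := fun x => x ** pv v)) => [|{}x y|[k p w q] [/= Hw [u' up] [u uq]]].
- exact: nmul0l.
- exact: numulDl.
rewrite /tval /mono numulZl -numulA /=.
have [->|re] := pselect (v = u); last first.
  by rewrite (star_pv0 uq) // nmul0r scaler0; apply: lin0.
rewrite (star_pv uq); apply: lin_term; split=> //=; first by exists u'.
by exists u.
Qed.

Lemma span_pes_l H e x : hereditary H -> span H x -> span H (pes e ** x).
Proof.
move=> hH; apply: (lin_map (h := fun x => pes e ** x))
  => [|{}x y|[k p w q] [/= Hw [u' up] [u uq]]].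
- exact: nmul0r.
- exact: numulDr.
rewrite /tval /mono numulZr numulA /=.
case: p up => [/= uw|f p /= [sf up]]; last first.
  rewrite path_elt_cons numulA.
  have [ef|ef] := pselect (e = f); last first.
    by rewrite psf0 // !nmul0l scaler0; apply: lin0.
  rewrite -ef pse pv_path ?ef //; apply: lin_term; split=> //=; first by exists (rng f).
  by exists u.
rewrite path_nil; have [sw|sw] := pselect (src e = w); last first.
  rewrite -psv -!numulA pv_star -(pv_star w) [pv (src e) ** _]numulA pvw0 //.
  by rewrite nmul0l nmul0r scaler0; apply: lin0.
(* With an empty real path, [e^* q^*] is the ghost path of [q e], and the middle vertex moves on to
   [rng e]. *)
have -> : pes e ** pv w ** star_elt w q = mono [::] (rng e) (rcons q e).
  rewrite /mono path_nil pv_star -cats1 -(@star_cat w) //= star_elt_cons star_nil pvs.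
  by rewrite -sw psv.
apply: lin_term; split=> /=; first by apply: hH; rewrite sw.
  by exists (rng e).
by exists u; rewrite -cats1; apply/walk_cat; exists w.
Qed.

Lemma span_pe_l H e x : span H x -> span H (pe e ** x).
Proof.
apply: (lin_map (h := fun x => pe e ** x)) => [|{}x y|[k p w q] [/= Hw [u' up] [u uq]]].
- exact: nmul0r.
- exact: numulDr.
rewrite /tval /mono numulZr numulA /=.
have [re|re] := pselect (rng e = u'); last first.
  rewrite -pev -[pe e ** pv _ ** _]numulA (pv_path0 up) // nmul0r nmul0l scaler0.
  exact: lin0.
rewrite -path_elt_cons; apply: lin_term; split=> //=; last by exists u.
by exists (src e); rewrite re.
Qed.

Lemma span_mulv_l H v x : span H x -> span H (pv v ** x).
Proof.
apply: (lin_map (h := fun x => pv v ** x)) => [|{}x y|[k p w q] [/= Hw [u' up] [u uq]]].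
- exact: nmul0r.
- exact: numulDr.
rewrite /tval /mono numulZr numulA /=.
have [->|re] := pselect (v = u'); last first.
  by rewrite (pv_path0 up) // nmul0l scaler0; apply: lin0.
rewrite (pv_path up); apply: lin_term; split=> //=; first by exists u'.
by exists u.
Qed.

Lemma span_mulr H x y : hereditary H -> span H x -> span (fun=> True) y -> span H (x ** y).
Proof.
move=> hH Hx; elim/lin_ind: y / => [|[k p w q] y _ IHy]; first by rewrite nmul0r; apply: lin0.
rewrite numulDr; apply: linD => //; rewrite /tval numulZr; apply: linZ => /=.
rewrite /mono numulA; have {Hx} : span H (x ** path_elt w p).
  elim: p (x) Hx => [|e p IHp] z Hz; first exact: span_mulv.
  by rewrite path_elt_cons numulA; apply: IHp; apply: span_pe.
move: (x ** _) => z Hz; elim: q => [|e q IHq]; first exact: span_mulv.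
by rewrite star_elt_cons numulA; apply: span_pes.
Qed.

Lemma span_mull H x y : hereditary H -> span (fun=> True) y -> span H x -> span H (y ** x).
Proof.
move=> hH Ty Hx; elim/lin_ind: y / Ty => [|[k p w q] y _ IHy].
  by rewrite nmul0l; apply: lin0.
rewrite numulDl; apply: linD => //; rewrite /tval numulZl; apply: linZ => /=.
rewrite /mono -numulA; have {Hx} : span H (star_elt w q ** x).
  elim: q (x) Hx => [|e q IHq] z Hz; first exact: span_mulv_l.
  by rewrite star_elt_cons -numulA; apply: IHq; apply: span_pes_l.
move: (_ ** x) => z Hz; elim: p => [|e p IHp]; first exact: span_mulv_l.
by rewrite path_elt_cons -numulA; apply: span_pe_l.
Qed.

Lemma span_pe_gen e : span (fun=> True) (pe e).
Proof. by rewrite -pve; apply: span_pe => //; apply: span_pv. Qed.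

Lemma span_pes_gen e : span (fun=> True) (pes e).
Proof. by rewrite -pvs; apply: span_pes => //; apply: span_pv. Qed.

End Monomials.

Arguments path_elt : simpl never.
Arguments star_elt : simpl never.

(** * Spanning by monomials, and local units *)

Section Generation.
Variables (E : graph) (K : fieldType) (A : nuAlg K).
Variables (pv : vert E -> A) (pe pes : edge E -> A).
Hypothesis LPA : is_leavitt_path_algebra pv pe pes.
Let LF : leavitt_family pv pe pes := LPA.1.
Let T : A -> Prop := span pv pe pes (fun=> True).

(* The span of the monomials is itself a Leavitt algebra; by uniqueness, the induced
   map into it followed by the inclusion is the identity of [A]. *)
Lemma span_full x : span pv pe pes (fun=> True) x.
Proof.
have T0 : T 0 by apply: lin0.
have TP (k : K) y z : T y -> T z -> T (k *: y + z).
  by move=> Ty Tz; apply: linD => //; apply: linZ.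
have TM y z : T y -> T z -> T (y ** z) by apply: span_mulr.
pose B := sub_alg T0 TP TM (@numulA K A) (@numulDl K A)
  (fun y z t _ => numulDr y z t) (@numulZl K A) (fun k y z _ => numulZr k y z).
pose qv v : B := sub_in (span_pv LF (v := v) I).
pose qe e : B := sub_in (span_pe_gen LF e).
pose qes e : B := sub_in (span_pes_gen LF e).
have LB : leavitt_family qv qe qes.
  split=> [v|]; first exact/val_inj/(pvv LF).
  split=> [v w vw|]; first exact/val_inj/(pvw0 LF vw).
  split=> [e|]; first by split; apply: val_inj; [apply: (pve LF) | apply: (pev LF)].
  split=> [e|]; first by split; apply: val_inj; [apply: (pvs LF) | apply: (psv LF)].
  split=> [e|]; first exact/val_inj/(pse LF).
  split=> [e f ef|v l ndl lP l0]; first exact/val_inj/(psf0 LF ef).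
  apply: val_inj; apply: etrans (ck2 LF ndl lP l0) _.
  elim: (l) => [|e l' IHl]; first by rewrite !big_nil.
  by rewrite !big_cons IHl.
have [f [[fD [fZ fM]] [fv [fe [fs _]]]]] := LPA.2 B qv qe qes LB.
have [g [_ [_ [_ [_ gu]]]]] := LPA.2 A pv pe pes LF.
have -> : x = val (f x).
  transitivity (g x); first exact: (gu id).
  symmetry; apply: (gu (fun y => val (f y))) => [|v|e|e].
  - split=> [y z|]; first by rewrite fD.
    by split=> [k y|y z]; rewrite ?fZ ?fM.
  - by rewrite fv.
  - by rewrite fe.
  - by rewrite fs.
exact: sub_carP.
Qed.

Lemma span_ideal H : hereditary H -> ideal (span pv pe pes H).
Proof.
move=> hH; split; first exact: lin0.
split=> [x y Hx Hy|r x Hx].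
  by apply: linD => //; rewrite -scaleN1r; apply: linZ.
by split; [apply: span_mull | apply: span_mulr] => //; apply: span_full.
Qed.

Lemma unit_of_vertices (vs : seq (vert E)) :
  exists u, forall v, List.In v vs -> u ** pv v = pv v /\ pv v ** u = pv v.
Proof.
have [ws [ndw wsP]] : exists ws, List.NoDup ws /\ forall v, List.In v vs -> List.In v ws.
  exists (List.nodup (fun v w => pselect (v = w)) vs); split=> [|v].
    exact: List.NoDup_nodup.
  by rewrite List.nodup_In.
(* The unit is the sum of the distinct vertices. That it kills all other vertices is what the
   induction needs when a vertex is added. *)
suff [u [uP _]] : exists u, (forall v, List.In v ws -> u ** pv v = pv v /\ pv v ** u = pv v)
    /\ (forall v, ~ List.In v ws -> u ** pv v = 0 /\ pv v ** u = 0).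
  by exists u => v /wsP/uP.
elim: ws ndw {wsP} => [|w ws IHws] ndw.
  by exists 0; split=> // v _; rewrite nmul0l nmul0r.
have [nw ndws] := (List.NoDup_cons_iff _ _).1 ndw.
have [u [uP u0]] := IHws ndws; exists (u + pv w).
split=> v; rewrite numulDl numulDr /=.
  have [wv|wv] := pselect (w = v); last first.
    have vw : v <> w by move=> h; apply: wv.
    by case=> // vws; rewrite (pvw0 LF wv) (pvw0 LF vw) !addr0; apply: uP.
  by move=> _; rewrite -wv; have [-> ->] := u0 w nw; rewrite (pvv LF) !add0r.
move=> nv; have [-> ->] : u ** pv v = 0 /\ pv v ** u = 0 by apply: u0; tauto.
have wv : w <> v by move=> h; apply: nv; left.
have vw : v <> w by move=> h; apply: wv.
by rewrite (pvw0 LF wv) (pvw0 LF vw) !addr0.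
Qed.

Lemma lpa_local_units : local_units A.
Proof.
(* [vs] collects the sources of [p] and [q] for all monomials [p q^*] of [x]. *)
move=> x; suff [vs vsP] : exists vs, forall u,
    (forall v, List.In v vs -> u ** pv v = pv v /\ pv v ** u = pv v) -> u ** x = x /\ x ** u = x.
  by have [u uP] := unit_of_vertices vs; exists u; apply: vsP.
elim/lin_ind: x / (span_full x) => [|[k p w q] x [/= _ [a ap] [b bq]] [vs vsP]].
  by exists [::] => u _; rewrite nmul0l nmul0r.
exists [:: a, b & vs] => u uP; rewrite numulDl numulDr.
have [-> ->] : u ** x = x /\ x ** u = x.
  by apply: vsP => v vvs; apply: uP; right; right.
rewrite /tval /mono numulZl numulZr /=.
have up : u ** path_elt pv pe w p = path_elt pv pe w p.
  by rewrite -(pv_path LF ap) numulA (uP a (or_introl erefl)).1.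
have qu : star_elt pv pes w q ** u = star_elt pv pes w q.
  by rewrite -(star_pv LF bq) -numulA (uP b (or_intror (or_introl erefl))).2.
by rewrite numulA up -numulA qu.
Qed.

End Generation.

(** * Reduction to a vertex *)

Lemma In_nth (T : Type) (x : T) (l : seq T) i : (i < size l)%N -> List.In (nth x l i) l.
Proof. by elim: l i => // y l IHl [|i] /=; [left | rewrite ltnS => /IHl; right]. Qed.

Lemma NoDup_map_inj (T U : Type) (f : T -> U) (l : seq T) :
  injective f -> List.NoDup l -> List.NoDup (map f l).
Proof.
move=> fI; elim: l => [|x l IHl] nd /=; first by constructor.
have [nx ndl] := (List.NoDup_cons_iff _ _).1 nd; constructor; last exact: IHl.
by move=> /In_map[y [/fI ->]].
Qed.

(* A word with a proper period repeats its last letter. *)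
Lemma shift_last_In (T : Type) (t d s : seq T) f : t <> [::] -> (size t <= size d)%N ->
  t ++ rcons d f = rcons d f ++ s -> List.In f d.
Proof.
move=> t0 td /(congr1 (fun l => nth f l (size d))).
rewrite [in RHS]nth_cat size_rcons ltnSn nth_rcons ltnn eqxx nth_cat ltnNge td /=.
have lt_d : (size d - size t < size d)%N.
  by case: (t) t0 td => // x t' _ /=; case: (size d) => // n _; rewrite subSS ltnS leq_subr.
by rewrite nth_rcons lt_d => <-; apply: In_nth.
Qed.

(** Run [n] times around a cycle at [w] and then along it to the source of an exit [f]. As [f] is
    not an edge of the cycle, it does not occur before. *)
Lemma long_exit_path (E : graph) (w : vert E) t n :
  (forall c, is_cycle c -> has_exit (E := E) c) -> t <> [::] -> walk w t w ->
  exists d f, [/\ walk w (rcons d f) (rng f), (n <= size d)%N & ~ List.In f d].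
Proof.
move=> exitE t0 wt; have [c [cc [c0 wc]]] := closed_walk_cycle t0 wt.
have [f [fc nf]] := exitE c cc; have [g [gf /In_split[c1 [c2 cE]]]] := In_map.1 fc.
have wc1 : walk w c1 (src f).
  by move: wc; rewrite cE => /walk_cat[x [wc1 /= [gx _]]]; rewrite -gf gx.
exists (cpow c n ++ c1), f; split.
- rewrite -cats1; apply: (@walk_trans _ _ _ (src f)) => //.
  by apply: walk_trans wc1; apply: walk_cpow.
- by rewrite size_cat (leq_trans (leq_size_cpow n c0)) // leq_addr.
- by move=> /In_cat[/In_cpow|] h; apply: nf => //; rewrite cE; apply/In_cat; left.
Qed.

Section Reduction.
Variables (E : graph) (K : fieldType) (A : nuAlg K).
Variables (pv : vert E -> A) (pe pes : edge E -> A).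
Hypothesis LPA : is_leavitt_path_algebra pv pe pes.
Let LF : leavitt_family pv pe pes := LPA.1.
Variable H : vert E -> Prop.
Hypothesis hH : hereditary H.

Lemma mulr_pv_eq0 (x : A) : (forall v, x ** pv v = 0) -> x = 0.
Proof.
move=> x0; have [u [_ <-]] := lpa_local_units LPA x.
elim/lin_ind: u / (span_full LPA u) => [|[k p w q] y [/= _ [a ap] _] IHy].
  by rewrite nmul0r.
rewrite numulDr IHy addr0 /tval numulZr /mono /= -(pv_path LF ap).
by rewrite !numulA x0 !nmul0l scaler0.
Qed.

Definition path_sum w (l : seq (K * seq (edge E))) : A :=
  \sum_(t <- l) t.1 *: path_elt pv pe w t.2.

Definition reduced w (l : seq (K * seq (edge E))) :=
  (forall t, List.In t l -> [/\ t.1 <> 0, H w & exists u, walk u t.2 w]) /\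
  List.NoDup (map snd l).

Lemma reduced_add u w k p l : H w -> walk u p w -> reduced w l ->
  exists l', reduced w l' /\ path_sum w l' = k *: path_elt pv pe w p + path_sum w l.
Proof.
move=> Hw up [lP ndl]; have [->|k0] := pselect (k = 0).
  by exists l; rewrite scale0r add0r.
have [|np] := pselect (List.In p (map snd l)); last first.
  exists ((k, p) :: l); rewrite /path_sum big_cons; split=> //; split; last by constructor.
  by move=> t [<-|/lP //]; split=> //; exists u.
move=> /In_map[[k' p'] [/= -> /In_split[l1 [l2 lE]]]].
have lE' : path_sum w l = k' *: path_elt pv pe w p + path_sum w (l1 ++ l2).
  by rewrite lE /path_sum !big_cat big_cons /= addrCA.
have nd' : List.NoDup (p :: map snd (l1 ++ l2)).
  move: ndl; rewrite lE !map_cat /= => /(List.NoDup_remove _ _ p)[nd nin].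
  by constructor.
have lP' t : List.In t (l1 ++ l2) -> [/\ t.1 <> 0, H w & exists u, walk u t.2 w].
  by move=> tl; apply: lP; rewrite lE; apply/In_cat => /=; move/In_cat: tl; tauto.
rewrite lE' addrA -scalerDl.
have [->|kk0] := pselect (k + k' = 0).
  exists (l1 ++ l2); rewrite scale0r add0r; split=> //; split=> //.
  by have [] := (List.NoDup_cons_iff _ _).1 nd'.
exists ((k + k', p) :: l1 ++ l2); rewrite /path_sum big_cons; split=> //; split=> //.
by move=> t [<-|/lP' //]; split=> //; exists u.
Qed.

(* [a v] splits into a combination of paths and one of monomials [p q^*] with [q] nontrivial;
   [F] collects the first edges of these [q]. *)
Lemma split_real n v (a : A) : lin pv pe pes (short_term_into H n) a ->
  exists l c F, [/\ a ** pv v = path_sum v l + c, reduced v l,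
    forall f, List.In f F -> src f = v /\ (0 < n)%N,
    forall F', List.NoDup F' -> (forall f, List.In f F -> List.In f F') ->
      c = \sum_(f <- F') (c ** pe f) ** pes f &
    forall f, ~ List.In f F -> c ** pe f = 0].
Proof.
elim/lin_ind: a / => [|[k p w q] x [[/= Hw [u' up] [u uq]] sq] [l [c [F [xE rl Fv cF c0]]]]].
  exists [::], 0, [::]; rewrite nmul0l /path_sum big_nil add0r; split=> //.
  - by split=> //; constructor.
  - by move=> F' _ _; rewrite big1 // => f _; rewrite !nmul0l.
  - by move=> f _; rewrite nmul0l.
have [uv|uv] := pselect (v = u); last first.
  exists l, c, F; split=> //.
  by rewrite numulDl xE /tval /mono numulZl -numulA /= (star_pv0 LF uq uv) nmul0r scaler0 add0r.
rewrite -{u}uv in uq.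
have tv : tval pv pe pes (Term k p w q) ** pv v = tval pv pe pes (Term k p w q).
  by rewrite /tval /mono numulZl -numulA (star_pv LF uq).
case: q uq sq tv => [/= vw _ tv|e q /= [se eq] sq tv].
  subst w; have [l' [rl' l'E]] := reduced_add k Hw up rl.
  exists l', c, F; split=> //.
  by rewrite numulDl xE tv addrA l'E /tval /mono /= star_nil (path_pv LF).
have te f : e <> f -> tval pv pe pes (Term k p w (e :: q)) ** pe f = 0.
  move=> ef; rewrite /tval /mono /= star_elt_cons numulZl -!numulA (psf0 LF ef).
  by rewrite !nmul0r scaler0.
have tee : (tval pv pe pes (Term k p w (e :: q)) ** pe e) ** pes e =
    tval pv pe pes (Term k p w (e :: q)).
  rewrite /tval /mono /= star_elt_cons !numulZl -!numulA; congr (_ *: (_ ** (_ ** _))).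
  by rewrite numulA (pse LF) (pvs LF).
exists l, (tval pv pe pes (Term k p w (e :: q)) + c), (e :: F); split=> //.
- by rewrite numulDl xE tv addrCA.
- by move=> f [<-|/Fv //]; split=> //; apply: leq_ltn_trans sq.
- move=> F' ndF' FF'; rewrite {1}(cF F') //; last by move=> f fF; apply: FF'; right.
  under [RHS]eq_bigr do rewrite !numulDl.
  rewrite big_split /=; congr (_ + _).
  have [l1 [l2 F'E]] := In_split (FF' e (or_introl erefl)).
  rewrite F'E in ndF' *; have [_ nin] := List.NoDup_remove _ _ _ ndF'.
  rewrite big_cat big_cons /= tee.
  have z m : ~ List.In e m ->
      \sum_(f <- m) (tval pv pe pes (Term k p w (e :: q)) ** pe f) ** pes f = 0.
    elim: m => [|f m IHm] nem; first by rewrite big_nil.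
    rewrite big_cons IHm ?addr0; last by move=> h; apply: nem; right.
    by rewrite te ?nmul0l // => h; apply: nem; left.
  rewrite !z ?add0r ?addr0 // => h; apply: nin; apply/In_cat; tauto.
- move=> f nf; rewrite numulDl c0 ?addr0; last by move=> h; apply: nf; right.
  by apply: te => h; apply: nf; left.
Qed.

Variable I : A -> Prop.
Hypothesis hI : ideal I.

Lemma sum_neq0 (T : Type) (s : seq T) (F : T -> A) : \sum_(t <- s) F t <> 0 ->
  exists t, List.In t s /\ F t <> 0.
Proof.
move=> s0; apply: contrapT => nF; apply: s0; elim: s nF => [|t s IHs] nF.
  by rewrite big_nil.
rewrite big_cons IHs; last by move=> [t' [ts Ft]]; apply: nF; exists t'; split=> //; right.
by rewrite addr0; apply: contrapT => Ft; apply: nF; exists t; split=> //; left.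
Qed.

(** Induction on the bound for ghost lengths: if [a ** pv v ** pe e] is nonzero for some [e] in [F],
    it has shorter ghost paths and lies in [I]. Such an edge exists if there are no real paths, and,
    by [ck2], if [F] lists all the edges at [v] and there are any. A further edge at [v] kills [c]
    instead. *)
Lemma ideal_real n (a : A) : lin pv pe pes (short_term_into H n) a -> I a -> a <> 0 ->
  exists w l, [/\ reduced w l, l <> [::] & I (path_sum w l)].
Proof.
elim: n a => [|n IHn] a Ha Ia a0.
all: have [v av0] : exists v, a ** pv v <> 0
  by apply: contrapT => nv; apply: a0; apply: mulr_pv_eq0 => v;
     apply: contrapT => h; apply: nv; exists v.
all: have [l [c [F [avE rl Fv cF c0]]]] := split_real v Ha.
all: pose F' := List.nodup (fun e f : edge E => pselect (e = f)) F.
all: have ndF' : List.NoDup F' by apply: List.NoDup_nodup.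
all: have F'F f : List.In f F' <-> List.In f F by rewrite List.nodup_In.
all: have cF' : c = \sum_(f <- F') (c ** pe f) ** pes f by apply: cF => // f /F'F.
  have F0 : F' = [::].
    by case: (F') F'F => // f s F'F; have [] := Fv f ((F'F f).1 (or_introl erefl)).
  rewrite F0 big_nil in cF'; rewrite cF' addr0 in avE.
  exists v, l; split=> //; last by rewrite -avE; apply: ideal_mulr.
  by move=> l0; apply: av0; rewrite avE l0 /path_sum big_nil.
have step : (exists e, List.In e F /\ (a ** pv v) ** pe e <> 0) ->
    exists w l, [/\ reduced w l, l <> [::] & I (path_sum w l)].
  move=> [e [/Fv[se _]]]; rewrite -numulA -se (pve LF) => ae0.
  by apply: (IHn (a ** pe e)) => //; [apply: (small_pe LF) Ha | apply: ideal_mulr].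
have [l0|l0] := pselect (l = [::]).
  apply: step; have ac : a ** pv v = c by rewrite avE l0 /path_sum big_nil add0r.
  have [|e [/F'F eF ce0]] := @sum_neq0 _ F' (fun f => (c ** pe f) ** pes f).
    by rewrite -cF' -ac.
  by exists e; split=> // h; apply: ce0; rewrite -ac h nmul0l.
(* An edge [f] outside [F] annihilates the ghost part and extends all the real paths, which remain
   distinct. *)
have [[f [sf nf]]|allF] := pselect (exists f, src f = v /\ ~ List.In f F).
  exists (rng f), (map (fun t => (t.1, rcons t.2 f)) l); split; last 1 first.
  - have -> : path_sum (rng f) [seq (t.1, rcons t.2 f) | t <- l] = (a ** pv v) ** pe f.
      rewrite avE numulDl c0 // addr0 /path_sum big_map nmul_suml; apply: eq_bigr => t _ /=.
      rewrite numulZl -cats1 -(path_cat LF (w := v)) //=.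
      by rewrite path_elt_cons path_nil (pev LF).
    by do !apply: ideal_mulr.
  - split.
      move=> t /In_map[[k p] [<- /rl.1[/= k0 Hv [u up]]]]; split=> //=.
        by apply: hH; rewrite sf.
      by exists u; rewrite -cats1; apply/walk_cat; exists v.
    rewrite -map_comp; have -> : map (snd \o (fun t : K * _ => (t.1, rcons t.2 f))) l =
        map (fun p => rcons p f) (map snd l) by rewrite -map_comp; apply: eq_map.
    apply: NoDup_map_inj; last exact: rl.2.
    by move=> p q /rcons_inj[].
  - by case: (l) l0.
have F'v f : List.In f F' <-> src f = v.
  split=> [/F'F/Fv[] //|sf]; apply/F'F; apply: contrapT => nf; apply: allF.
  by exists f.
have [F0|F0] := pselect (F' = [::]).
  rewrite F0 big_nil in cF'; rewrite cF' addr0 in avE.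
  by exists v, l; split=> //; rewrite -avE; apply: ideal_mulr.
apply: step; have [|e [/F'F eF ae0]] :=
    @sum_neq0 _ F' (fun f => ((a ** pv v) ** pe f) ** pes f).
  under eq_bigr do rewrite -numulA.
  by rewrite -nmul_sumr -(ck2 LF ndF' F'v F0) -numulA (pvv LF).
by exists e; split=> // h; apply: ae0; rewrite h nmul0l.
Qed.

(** A product [p^* q] is zero unless [q = p t], by minimality of the length of [p]. Since [p] and
    [q] have the same ends, [t] is closed at [w], and it is nonempty as [q] differs from [p]. *)
Lemma cancel_shortest u w p (l : seq (K * seq (edge E))) : walk u p w ->
  (forall t, List.In t l -> [/\ t.2 <> p, (size p <= size t.2)%N & exists u, walk u t.2 w]) ->
  exists l', (forall t, List.In t l' -> t.2 <> [::] /\ walk w t.2 w) /\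
    star_elt pv pes w p ** path_sum w l = path_sum w l'.
Proof.
move=> up; elim: l => [|[k q] l IHl] lP.
  by exists [::]; rewrite /path_sum !big_nil nmul0r.
have [|l' [l'P l'E]] := IHl; first by move=> t tl; apply: lP; right.
have [/= qp spq [u' uq]] := lP (k, q) (or_introl erefl).
rewrite {1}/path_sum big_cons numulDr l'E numulZr /=.
have [uu'|uu'] := pselect (u = u'); last first.
  exists l'; split=> //.
  by rewrite -(star_pv LF up) -numulA (pv_path0 LF uq uu') nmul0r scaler0 add0r.
have [[t qE]|nc] := pselect (comparable_words p q); last first.
  by exists l'; split=> //; rewrite (star_path0 LF) // scaler0 add0r.
have {}qE : q = p ++ t.
  case: qE => // pE; have := spq; rewrite pE size_cat -[X in (_ <= X)%N]addn0 leq_add2l.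
  by case: t pE qp => // pE; rewrite pE !cats0.
have wt : walk w t w.
  by move: uq; rewrite qE -uu' => /walk_cat[x [/(walk_end up) <-]].
exists ((k, t) :: l'); split=> [s [<-|/l'P //]|].
  by split=> //= t0; apply: qp; rewrite qE t0 cats0.
by rewrite qE (star_path_cat LF up wt) /path_sum big_cons.
Qed.

Lemma ideal_pv_scale k v : k <> 0 -> I (k *: pv v) -> I (pv v).
Proof.
move=> /eqP k0 /(ideal_mull (k^-1 *: pv v) hI).
by rewrite numulZl numulZr (pvv LF) scalerA mulVf // scale1r.
Qed.

Hypothesis exitE : forall c, is_cycle c -> has_exit (E := E) c.

(** Cancelling a shortest path leaves [k w] plus a combination of nonempty closed paths at [w].
    Conjugation by a long path that ends with an exit kills these closed paths and turns [k w] into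
    a multiple of a vertex. *)
Lemma ideal_vertex n (a : A) : lin pv pe pes (short_term_into H n) a -> I a -> a <> 0 ->
  exists v, H v /\ I (pv v).
Proof.
move=> Ha Ia a0; have [w [l [[lP ndl] l0 Il]]] := ideal_real Ha Ia a0.
have [|p [pl pmin]] := @ex_minimal_size _ (fun p => List.In p (map snd l)).
  by case: (l) l0 => // t l' _; exists t.2; left.
move: pl => /In_map[[k p'] [/= pp' /In_split[l1 [l2 lE]]]]; subst p'.
have [k0 Hw [u up]] : [/\ k <> 0, H w & exists u, walk u p w].
  by apply: (lP (k, p)); rewrite lE; apply/In_cat; right; left.
have [|l' [l'P l'E]] := @cancel_shortest u w p (l1 ++ l2) up.
  move=> t tl; have tl' : List.In t l.
    by rewrite lE; apply/In_cat => /=; move/In_cat: tl; tauto.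
  split; last by have [] := lP t tl'.
    move: ndl; rewrite lE map_cat /= => ndl' tp.
    apply: (List.NoDup_remove_2 _ _ _ ndl').
    have : List.In p (map snd (l1 ++ l2)) by apply/In_map; exists t.
    by rewrite map_cat.
  by apply: pmin; apply/In_map; exists t.
have Iw : I (k *: pv w + path_sum w l').
  have := ideal_mull (star_elt pv pes w p) hI Il.
  have -> : path_sum w l = k *: path_elt pv pe w p + path_sum w (l1 ++ l2).
    by rewrite lE /path_sum !big_cat big_cons /= addrCA.
  by rewrite numulDr numulZr (star_path LF up) l'E.
have [l'0|l'0] := pselect (l' = [::]).
  exists w; split=> //; apply: (ideal_pv_scale k0).
  by move: Iw; rewrite l'0 /path_sum big_nil addr0.
have [t0 [t0N wt0]] : exists t, t <> [::] /\ walk w t w.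
  by case: (l') l'0 l'P => // t s _ /(_ t (or_introl erefl)); exists t.2.
have [m mP] : exists m, forall t, List.In t l' -> (size t.2 <= m)%N.
  elim: (l') => [|t s [m mP]]; first by exists 0%N.
  exists (maxn (size t.2) m) => t' [<-|/mP le]; first exact: leq_maxl.
  by rewrite leq_max le orbT.
(* [d] is at least as long as each closed path [t]: were [t d f] comparable with [d f], the
   periodicity would force [f] to occur in [d]. *)
have [d [f [wd le_md nfd]]] := long_exit_path m exitE t0N wt0.
exists (rng f); split; first exact: hereditary_walk wd Hw.
apply: (ideal_pv_scale k0).
have := ideal_mull (star_elt pv pes (rng f) (rcons d f)) hI
  (ideal_mulr (path_elt pv pe (rng f) (rcons d f)) hI Iw).
rewrite numulDl numulDr numulZl numulZr (pv_path LF wd) (star_path LF wd).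
rewrite /path_sum nmul_suml nmul_sumr.
have -> : \sum_(t <- l') star_elt pv pes (rng f) (rcons d f) **
    (t.1 *: path_elt pv pe w t.2 ** path_elt pv pe (rng f) (rcons d f)) = 0.
  elim: (l') l'P mP => [|t s IHs] sP mP; first by rewrite big_nil.
  rewrite big_cons IHs ?addr0; last first.
  - by move=> t' ts; apply: mP; right.
  - by move=> t' ts; apply: sP; right.
  have [tN wt] := sP t (or_introl erefl); have szt := mP t (or_introl erefl).
  rewrite numulZl numulZr (path_cat LF _ wd) (star_path0 LF) ?scaler0 //.
  move=> [r [h|h]].
    move/(congr1 size): h; rewrite !size_cat addnAC -[LHS]add0n => /eqP.
    by rewrite eqn_add2r eq_sym addn_eq0; case: (t.2) tN.
  by apply: nfd; apply: shift_last_In tN _ h; apply: leq_trans le_md.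
by rewrite addr0.
Qed.

Lemma ideal_span_eq0 : (forall v, H v -> ~ I (pv v)) ->
  forall a, I a -> span pv pe pes H a -> a = 0.
Proof.
move=> HI a Ia /span_small[n Ha]; apply: contrapT => a0.
by have [v [Hv]] := ideal_vertex Ha Ia a0; apply: HI.
Qed.

End Reduction.

(** * From strongly all-reflexive graphs to Boolean ideal lattices *)

Section GraphToLattice.
Variables (E : graph) (K : fieldType) (A : nuAlg K).
Variables (pv : vert E -> A) (pe pes : edge E -> A).
Hypothesis LPA : is_leavitt_path_algebra pv pe pes.
Let LF : leavitt_family pv pe pes := LPA.1.

Lemma ideal_full (I : A -> Prop) : ideal I -> (forall v, I (pv v)) -> forall x, I x.
Proof.
move=> hI Iv x; elim/lin_ind: x / (span_full LPA x) => [|[k p w q] x _ Ix].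
  exact: ideal0.
apply: idealD => //; rewrite /tval /mono /= -numulZl -(path_pv LF) numulZl -numulZl.
by apply: ideal_mulr => //; rewrite -numulZl; apply: ideal_mull.
Qed.

Lemma sar_boolean : strongly_all_reflexive E -> ideal_lattice_boolean A.
Proof.
move=> sarE; have compl (I : A -> Prop) : ideal I -> exists J, [/\ ideal J,
    seteq (iinter I J) (@izero K A) & forall x, isum I J x].
  move=> hI; pose H' v := forall w, I (pv w) -> ~ reaches v w.
  have hH' : hereditary H'.
    by move=> e He w Iw ew; apply: (He w Iw); apply: reaches_trans ew; apply: reaches_edge.
  have hJ := span_ideal LPA hH'.
  exists (span pv pe pes H'); split=> // [x|].
    split=> [[Ix Jx]|->]; last by split; apply: ideal0.
    apply: (ideal_span_eq0 LPA hH' hI sarE.2 _ Ix Jx) => v H'v Iv.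
    by apply: (H'v v Iv); apply: reaches_refl.
  have hS := isum_ideal hI hJ; apply: ideal_full => //.
  apply: (saturation_full (H := fun v => I (pv v)) (S := fun v => isum I _ (pv v)) sarE).
  - exact: (vertices_hereditary LF).
  - exact: (vertices_hereditary LF).
  - exact: (vertices_saturated LF).
  - by move=> v Iv; apply: isuml.
  - by move=> v H'v; apply: isumr => //; apply: (span_pv LF).
split=> [I J L hI hJ hL|I hI].
  have [I' [hI' I0 I1]] := compl I hI.
  exact: (complemented_distributive (lpa_local_units LPA) hI hI' hJ hL I0 I1).
by have [J [hJ J0 J1]] := compl I hI; exists J.
Qed.

End GraphToLattice.

(** * The representation on infinite paths *)

Section Endomorphisms.
Variables (K : fieldType) (M : lmodType K).

Definition linear_map (f : M -> M) := forall (k : K) x y, f (k *: x + y) = k *: f x + f y.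

Let comp (f g : M -> M) : M -> M := fun x => f (g x).

Let lin_zero : linear_map 0.
Proof. by move=> k x y; change (0 = k *: 0 + 0 :> M); rewrite scaler0 addr0. Qed.

Let lin_comb (k : K) f g : linear_map f -> linear_map g -> linear_map (k *: f + g).
Proof.
move=> lf lg a x y; change (k *: f (a *: x + y) + g (a *: x + y) =
  a *: (k *: f x + g x) + (k *: f y + g y)).
by rewrite lf lg !scalerDr !scalerA mulrC addrACA.
Qed.

Let lin_comp f g : linear_map f -> linear_map g -> linear_map (comp f g).
Proof. by move=> lf lg a x y; rewrite /comp lg lf. Qed.

Lemma linear_mapD f x y : linear_map f -> f (x + y) = f x + f y.
Proof. by move=> lf; have := lf 1 x y; rewrite !scale1r. Qed.

Lemma linear_map0 f : linear_map f -> f 0 = 0.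
Proof. by move=> lf; apply: (addrI (f 0)); rewrite -linear_mapD // !addr0. Qed.

Lemma linear_mapZ f k x : linear_map f -> f (k *: x) = k *: f x.
Proof. by move=> lf; have := lf k x 0; rewrite (linear_map0 lf) !addr0. Qed.

Let comp_linDr f g h : linear_map f -> comp f (g + h) = comp f g + comp f h.
Proof. by move=> lf; apply: funext => x; apply: linear_mapD. Qed.

Let comp_linZr (k : K) f g : linear_map f -> comp f (k *: g) = k *: comp f g.
Proof. by move=> lf; apply: funext => x; apply: linear_mapZ. Qed.

Definition end_alg : nuAlg K :=
  sub_alg lin_zero lin_comb lin_comp (fun _ _ _ => erefl) (fun _ _ _ => erefl)
    comp_linDr (fun _ _ _ => erefl) comp_linZr.

Definition end_of f (lf : linear_map f) : end_alg := sub_in lf.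

Definition end_fun (a : end_alg) : M -> M := val a.

Lemma end_fun_lin a : linear_map (end_fun a).
Proof. exact: sub_carP. Qed.

Lemma end_ext (a b : end_alg) : (forall x, end_fun a x = end_fun b x) -> a = b.
Proof. by move=> ab; apply/val_inj/funext. Qed.

Lemma end_mulE (a b : end_alg) x : end_fun (a ** b) x = end_fun a (end_fun b x).
Proof. by []. Qed.

Lemma end_addE (a b : end_alg) x : end_fun (a + b) x = end_fun a x + end_fun b x.
Proof. by []. Qed.

Lemma end_0E x : end_fun 0 x = 0.
Proof. by []. Qed.

Lemma end_sumE (T : Type) (s : seq T) (F : T -> end_alg) x :
  end_fun (\sum_(t <- s) F t) x = \sum_(t <- s) end_fun (F t) x.
Proof. by elim: s => [|t s IHs]; rewrite ?big_nil // !big_cons end_addE IHs. Qed.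

End Endomorphisms.

Section PathRepresentation.
Variables (E : graph) (K : fieldType).

(* Infinite paths, where [None] is a step staying at a sink. *)
Let X := nat -> vert E * option (edge E).

Definition valid (x : X) := forall n,
  if (x n).2 is Some e then src e = (x n).1 /\ rng e = (x n.+1).1
  else (forall e, src e <> (x n).1) /\ (x n.+1).1 = (x n).1.

Definition tail (x : X) : X := fun n => x n.+1.

Definition push (e : edge E) (x : X) : X :=
  fun n => if n is n'.+1 then x n' else (src e, Some e).

Lemma valid_tail x : valid x -> valid (tail x).
Proof. by move=> vx n; apply: vx. Qed.

Lemma valid_push e x : valid (push e x) <-> valid x /\ (x 0%N).1 = rng e.
Proof.
split=> [vx|[vx x0] [|n]] /=; [split=> [n|]|by rewrite x0|exact: vx].
  exact: (vx n.+1).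
by have [_ /= ->] := vx 0%N.
Qed.

Lemma push_tail e x : valid x -> (x 0%N).2 = Some e -> push e (tail x) = x.
Proof.
move=> vx x0; apply: funext => -[|n] //=; have := vx 0%N; rewrite x0 => -[-> _].
by rewrite -x0; case: (x 0%N).
Qed.

(** Choose an outgoing edge at every vertex that is not a sink, and iterate. Such a path is what
    makes each vertex act nontrivially. *)
Lemma valid_exists v : exists x, valid x /\ (x 0%N).1 = v.
Proof.
have /choice[s sP] (u : vert E) : exists o : option (edge E),
    if o is Some e then src e = u else forall e, src e <> u.
  have [[e eu]|ne] := pselect (exists e : edge E, src e = u); first by exists (Some e).
  by exists None => e eu; apply: ne; exists e.
pose nx u := if s u is Some e then rng e else u.
exists (fun n => (iter n nx v, s (iter n nx v))); split=> // n /=.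
by move: (iter n nx v) => u; have := sP u; rewrite /nx; case: (s u).
Qed.

Let V : lmodType K := X -> K^o.

Let op_fun (P : X -> Prop) (g : X -> X) (f : V) : V :=
  fun x => if `[< P x >] then f (g x) else 0.

Let op_lin P g : linear_map (op_fun P g).
Proof.
move=> k f h; apply: funext => x; change (op_fun P g (k *: f + h) x =
  k *: op_fun P g f x + op_fun P g h x).
by rewrite /op_fun; case: asboolP => // _; rewrite scaler0 addr0.
Qed.

Definition op P g : end_alg V := end_of (@op_lin P g).

Lemma opE P g f x : end_fun (op P g) f x = if `[< P x >] then f (g x) else 0.
Proof. by []. Qed.

Lemma op_mul P Q g h : op P g ** op Q h = op (fun x => P x /\ Q (g x)) (fun x => h (g x)).
Proof.
apply: end_ext => f; apply: funext => x; rewrite end_mulE !opE.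
case: asboolP => Px; last by rewrite asboolF // => -[].
by case: asboolP => Qx; [rewrite asboolT | rewrite asboolF // => -[]].
Qed.

Lemma op_ext P Q g h : (forall x, P x <-> Q x) -> (forall x, P x -> g x = h x) ->
  op P g = op Q h.
Proof.
move=> PQ gh; apply: end_ext => f; apply: funext => x; rewrite !opE.
by case: asboolP => Px; [rewrite asboolT -?gh //; apply/PQ | rewrite asboolF // => /PQ].
Qed.

Lemma op0 P g : (forall x, ~ P x) -> op P g = 0.
Proof.
by move=> nP; apply: end_ext => f; apply: funext => x; rewrite opE asboolF //; apply: nP.
Qed.

(** Precomposition reverses directions: removing a first edge on points makes [rep_e e] send the
    indicator function of a path [x] starting at [rng e] to that of [e x]. *)
Definition rep_v v := op (fun x => valid x /\ (x 0%N).1 = v) (fun x => x).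
Definition rep_e e := op (fun x => valid x /\ (x 0%N).2 = Some e) tail.
Definition rep_s e := op (fun x => valid x /\ (x 0%N).1 = rng e) (push e).

Lemma path_rep : leavitt_family rep_v rep_e rep_s.
Proof.
have hd x e : valid x -> (x 0%N).2 = Some e -> src e = (x 0%N).1 /\ rng e = (tail x 0%N).1.
  by move=> vx x0; have := vx 0%N; rewrite x0.
split=> [v|]; first by rewrite /rep_v op_mul; apply: op_ext => // x; tauto.
split=> [v w vw|].
  by rewrite /rep_v op_mul op0 // => x [[_ xv] [_ xw]]; apply: vw; rewrite -xv.
split=> [e|].
  split; rewrite /rep_v /rep_e op_mul; apply: op_ext => // x; split=> [|[vx x0]]; try tauto.
    by have [-> _] := hd x e vx x0.
  by have [_ ->] := hd x e vx x0; do !split=> //; apply: valid_tail.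
split=> [e|].
  split; rewrite /rep_v /rep_s op_mul; apply: op_ext => // x; split=> [|[vx x0]]; try tauto.
  by do !split=> //; apply/valid_push.
split=> [e|].
  rewrite /rep_s /rep_e /rep_v op_mul; apply: op_ext => // x; split=> [|[vx x0]]; first tauto.
  by do !split=> //; apply/valid_push.
split=> [e f ef|v l ndl lP l0].
  by rewrite /rep_s /rep_e op_mul op0 // => x [_ [_ /= [fe]]]; apply: ef.
have ee e : rep_e e ** rep_s e = op (fun x => valid x /\ (x 0%N).2 = Some e) (fun x => x).
  rewrite /rep_s /rep_e op_mul; apply: op_ext => x; last by case=> -[vx x0] _; apply: push_tail.
  split=> [|[vx x0]]; first tauto.
  by have [_ ->] := hd x e vx x0; do !split=> //; apply: valid_tail.
apply: end_ext => f; apply: funext => x; rewrite end_sumE.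
have -> : (\sum_(e <- l) end_fun (rep_e e ** rep_s e) f) x =
    \sum_(e <- l) (if `[< valid x /\ (x 0%N).2 = Some e >] then f x else 0).
  elim: (l) => [|e s IHs]; first by rewrite !big_nil.
  by rewrite !big_cons -IHs ee.
(* A path has one first edge and [l] has no repetitions, so at most one summand is nonzero. *)
have -> : \sum_(e <- l) (if `[< valid x /\ (x 0%N).2 = Some e >] then f x else 0) =
    if `[< valid x /\ exists e, List.In e l /\ (x 0%N).2 = Some e >] then f x else 0.
  elim: (l) ndl => [|e s IHs] nds.
    by rewrite big_nil asboolF // => -[_ [e [[]]]].
  have [ne ndl'] := (List.NoDup_cons_iff _ _).1 nds; rewrite big_cons IHs //.
  case: asboolP => [[vx xe]|nxe].
    rewrite asboolF ?addr0; last first.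
      by move=> [_ [e' []]]; rewrite xe => es [ee']; apply: ne; rewrite ee'.
    by rewrite asboolT //; split=> //; exists e; split=> //; left.
  rewrite add0r; congr (if _ then _ else _); apply: asbool_equiv_eq.
  split=> -[vx [e' [es xe]]]; split=> //; exists e'; split=> //; first by right.
  by case: es => // ee'; case: nxe; rewrite ee'.
rewrite opE; congr (if _ then _ else _); apply: asbool_equiv_eq.
split=> -[vx]; last by case=> e [/lP el xe]; have [<- _] := hd x e vx xe.
move=> xv; split=> //; have := vx 0%N; case xo: (x 0%N).2 => [e|] [h _].
  by exists e; split=> //; apply/lP; rewrite h.
by case: (l) l0 lP => // e s _ lP; case: (h e); rewrite xv; apply/lP; left.
Qed.

Lemma rep_v_neq0 v : rep_v v <> 0.
Proof.
have [x [vx xv]] := valid_exists v.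
move=> /(congr1 (fun a => end_fun a (fun _ => 1) x)).
by rewrite opE asboolT // end_0E => /eqP; rewrite (oner_eq0 K).
Qed.

(** * A cycle without exits acts as its base vertex *)

Section NoExit.
Variables (c : seq (edge E)).
Hypotheses (cc : is_cycle c) (nexit : ~ has_exit c).

(** Without exits, [f] also lies on the cycle, whose edges have distinct sources. *)
Let det e f : List.In e c -> src f = src e -> f = e.
Proof.
move=> ec fe; have fc : List.In f c.
  apply: contrapT => nf; apply: nexit; exists f; split=> //.
  by apply/In_map; exists e.
have [_ [_ nd]] := (cycleP c).1 cc; move: ec fc fe nd.
elim: c => //= g s IHs [->|es] [->|fs] fe nd //;
  have [ng nds] := (List.NoDup_cons_iff _ _).1 nd; last exact: IHs.
- by case: ng; rewrite -fe; apply/In_map; exists f.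
- by case: ng; rewrite fe; apply/In_map; exists e.
Qed.

Let next e : List.In e c -> on_cycle c (rng e).
Proof.
move=> ec; have ce : on_cycle c (src e) by apply/In_map; exists e.
have [[|g p] [// _ [/= [gs gp] c'P]]] := on_cycle_rot cc ce.
have gE : g = e by apply: det.
rewrite gE in gp c'P; case: p gp c'P => [/= -> //|h p /= [<- _] c'P].
by apply/In_map; exists h; split=> //; apply/c'P; right; left.
Qed.

Let head x : valid x -> on_cycle c (x 0%N).1 ->
  exists e, [/\ List.In e c, src e = (x 0%N).1 & (x 0%N).2 = Some e].
Proof.
move=> vx /In_map[e [ex ec]]; exists e; split=> //.
have := vx 0%N; case: (x 0%N).2 => [f [fx _]|[h _]]; last by case: (h e).
by congr Some; apply: det => //; rewrite fx.
Qed.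

Let uniq_path x y : valid x -> valid y -> on_cycle c (x 0%N).1 ->
  (x 0%N).1 = (y 0%N).1 -> x = y.
Proof.
move=> vx vy cx xy; apply: funext => n.
elim: n x y vx vy cx xy => [|n IHn] x y vx vy cx xy.
  have [e [ec ex xe]] := head vx cx; have [f [fc fy yf]] : exists f,
      [/\ List.In f c, src f = (y 0%N).1 & (y 0%N).2 = Some f] by apply: head => //; rewrite -xy.
  have ef : e = f by apply: det => //; rewrite ex fy.
  by move: xy xe yf; rewrite ef; case: (x 0%N) (y 0%N) => [? ?] [? ?] /= -> -> ->.
have [e [ec ex xe]] := head vx cx; have [f [fc fy yf]] : exists f,
    [/\ List.In f c, src f = (y 0%N).1 & (y 0%N).2 = Some f] by apply: head => //; rewrite -xy.
have ef : e = f by apply: det => //; rewrite ex fy.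
have := vx 0%N; have := vy 0%N; rewrite xe yf => -[_ fy1] [_ ex1].
apply: (IHn (tail x) (tail y)); try exact: valid_tail.
  by rewrite /tail -ex1; apply: next.
by rewrite /tail -ex1 -fy1 ef.
Qed.

Let rep_path u p w x y f : walk u p w -> (forall e, List.In e p -> List.In e c) ->
  valid x -> (x 0%N).1 = u -> valid y -> (y 0%N).1 = w -> on_cycle c w ->
  end_fun (path_elt rep_v rep_e w p) f x = f y.
Proof.
move=> + + + + vy yw cw; elim: p u x => [|e p IHp] u x /= up pc vx xu.
  rewrite path_nil opE asboolT; last by rewrite xu.
  by congr f; apply: uniq_path => //; rewrite xu up // yw.
have [se ep] := up; have ec : List.In e c by apply: pc; left.
have [e' [e'c e'x xe']] : exists e, [/\ List.In e c, src e = (x 0%N).1 & (x 0%N).2 = Some e].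
  by apply: head => //; rewrite xu -se; apply/In_map; exists e.
have e'E : e' = e by apply: det => //; rewrite e'x xu se.
rewrite path_elt_cons end_mulE opE asboolT ?xe' ?e'E //.
apply: (IHp (rng e)) => //; first by move=> g gp; apply: pc; right.
  exact: valid_tail.
by have := vx 0%N; rewrite xe' e'E => -[_ <-].
Qed.

(** Only one infinite path starts at [v], by [uniq_path]; removing [c] from its beginning gives a
    path from [v], hence the same path again. *)
Lemma rep_no_exit v : walk v c v -> path_elt rep_v rep_e v c = rep_v v.
Proof.
move=> vc; have [c0 _] := (cycleP c).1 cc.
have cv := walk_on_cycle c0 vc.
apply: end_ext => f; apply: funext => x; rewrite [RHS]opE.
case: asboolP => [[vx xv]|nx]; first exact: (rep_path f vc).
have -> : path_elt rep_v rep_e v c = rep_v v ** path_elt rep_v rep_e v c.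
  by rewrite (pv_path path_rep vc).
by rewrite end_mulE opE asboolF.
Qed.

End NoExit.
End PathRepresentation.

(** * The grading *)

Section Grading.
Variables (E : graph) (K : fieldType) (A : nuAlg K).
Variables (pv : vert E -> A) (pe pes : edge E -> A).
Hypothesis LPA : is_leavitt_path_algebra pv pe pes.
Let LF : leavitt_family pv pe pes := LPA.1.

Lemma lpa_ind (P : A -> Prop) : P 0 -> (forall x y, P x -> P y -> P (x + y)) ->
  (forall (k : K) x, P x -> P (k *: x)) -> (forall x y, P x -> P y -> P (x ** y)) ->
  (forall v, P (pv v)) -> (forall e, P (pe e)) -> (forall e, P (pes e)) -> forall x, P x.
Proof.
move=> P0 PD PZ PM Pv Pe Ps x.
elim/lin_ind: x / (span_full LPA x) => [//|[k p w q] x _ Px].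
apply: PD => //; apply: PZ; apply: (PM) => /=.
  by elim: p => [|e p IHp]; [apply: Pv | apply: PM].
by elim: q => [|e q IHq]; [apply: Pv | apply: PM].
Qed.

(** A function [f] stands for a two-sided formal series with coefficient [f n] at [t^n], and
    [shift_op a d] is multiplication by [a t^d]. Real edges get degree 1 and ghost edges degree
    -1. *)
Let V : lmodType K := int -> A.

Let shift_fun (a : A) (d : int) (f : V) : V := fun n => a ** f (n - d).

Let shift_lin a d : linear_map (shift_fun a d).
Proof.
move=> k f h; apply: funext => n; change (a ** (k *: f (n - d) + h (n - d)) =
  k *: (a ** f (n - d)) + a ** h (n - d)).
by rewrite numulDr numulZr.
Qed.

Definition shift_op a d : end_alg V := end_of (@shift_lin a d).

Lemma shift_opE a d f n : end_fun (shift_op a d) f n = a ** f (n - d).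
Proof. by []. Qed.

Lemma shift_opM a b c d : shift_op a c ** shift_op b d = shift_op (a ** b) (c + d).
Proof.
apply: end_ext => f; apply: funext => n.
by rewrite end_mulE !shift_opE numulA opprD addrA.
Qed.

Lemma shift_op0 d : shift_op 0 d = 0.
Proof. by apply: end_ext => f; apply: funext => n; rewrite shift_opE nmul0l. Qed.

Lemma grading_rep : leavitt_family (fun v => shift_op (pv v) 0)
  (fun e => shift_op (pe e) 1) (fun e => shift_op (pes e) (- 1)).
Proof.
split=> [v|]; first by rewrite shift_opM (pvv LF).
split=> [v w vw|]; first by rewrite shift_opM (pvw0 LF vw) shift_op0.
split=> [e|]; first by rewrite !shift_opM (pve LF) (pev LF).
split=> [e|]; first by rewrite !shift_opM (pvs LF) (psv LF).
split=> [e|]; first by rewrite shift_opM (pse LF).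
split=> [e f ef|v l ndl lP l0]; first by rewrite shift_opM (psf0 LF ef) shift_op0.
rewrite (ck2 LF ndl lP l0); under [RHS]eq_bigr do rewrite shift_opM subrr.
apply: end_ext => f; apply: funext => n; rewrite end_sumE shift_opE nmul_suml.
elim: (l) => [|e s IHs]; first by rewrite !big_nil.
by rewrite !big_cons IHs.
Qed.

Section GradedMap.
Variable h : A -> end_alg V.
Hypothesis hh : alg_hom h.
Hypothesis hv : forall v, h (pv v) = shift_op (pv v) 0.
Hypothesis he : forall e, h (pe e) = shift_op (pe e) 1.
Hypothesis hs : forall e, h (pes e) = shift_op (pes e) (- 1).

Let hD x y f n : end_fun (h (x + y)) f n = end_fun (h x) f n + end_fun (h y) f n.
Proof. by have [-> _] := hh. Qed.

Let hZ k x f n : end_fun (h (k *: x)) f n = k *: end_fun (h x) f n.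
Proof. by have [_ [-> _]] := hh. Qed.

Let hM x y f n : end_fun (h (x ** y)) f n = end_fun (h x) (end_fun (h y) f) n.
Proof. by have [_ [_ ->]] := hh. Qed.

Let h0 f n : end_fun (h 0) f n = 0.
Proof. by have := hZ 0 0 f n; rewrite !scale0r. Qed.

Lemma graded_local x : exists N : nat, forall f n,
  (forall k, (`|k - n| <= N)%N -> f k = 0) -> end_fun (h x) f n = 0.
Proof.
elim/lpa_ind: x => [|x y [N hx] [N' hy]|k x [N hx]|x y [N hx] [N' hy]|v|e|e].
- by exists 0%N => f n _; rewrite h0.
- exists (maxn N N') => f n f0; rewrite hD hx ?hy ?addr0 // => k le; apply: f0; lia.
- by exists N => f n f0; rewrite hZ hx ?scaler0.
- exists (N + N')%N => f n f0; rewrite hM hx // => k le; apply: hy => j le'; apply: f0; lia.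
- by exists 0%N => f n f0; rewrite hv shift_opE f0 ?nmul0r // subr0; lia.
- by exists 1%N => f n f0; rewrite he shift_opE f0 ?nmul0r //; lia.
- by exists 1%N => f n f0; rewrite hs shift_opE f0 ?nmul0r //; lia.
Qed.

(** Constant functions are invariant under shifts, so on them the degrees are forgotten and [x] acts
    by plain multiplication. *)
Lemma graded_const x a n : end_fun (h x) (fun=> a) n = x ** a.
Proof.
elim/lpa_ind: x a n => [|x y hx hy|k x hx|x y hx hy|v|e|e] a n.
- by rewrite h0 nmul0l.
- by rewrite hD hx hy numulDl.
- by rewrite hZ hx numulZl.
- have -> : end_fun (h (x ** y)) (fun=> a) n = end_fun (h x) (fun=> y ** a) n.
    by rewrite hM; congr (end_fun (h x) _ n); apply: funext => m; rewrite hy.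
  by rewrite hx numulA.
- by rewrite hv.
- by rewrite he.
- by rewrite hs.
Qed.

Lemma graded_path w p : h (path_elt pv pe w p) = shift_op (path_elt pv pe w p) (size p)%:Z.
Proof.
elim: p => [|e p IHp]; first exact: hv.
by have [_ [_ hM']] := hh; rewrite path_elt_cons hM' IHp he shift_opM.
Qed.

(** Truncating the constant function to radius [m] does not change the value at 0, by locality, and
    makes the support bounded below, by [-m] before and by [-2m] after applying [h x]. *)
Lemma graded_window x a : exists N : nat, forall m : nat, (N <= m)%N ->
  end_fun (h x) (fun n => if (`|n| <= m)%N then a else 0) 0 = x ** a /\
  forall n : int, (n < - (m + m)%:Z)%R ->
     end_fun (h x) (fun n => if (`|n| <= m)%N then a else 0) n = 0.
Proof.
have [N hN] := graded_local x; exists N => m le_Nm; split; last first.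
  by move=> n ltn; apply: hN => k le; rewrite ifN //; lia.
rewrite -[RHS](graded_const x a 0); apply/eqP; rewrite -subr_eq0; apply/eqP.
pose f : V := fun n => if (`|n| <= m)%N then a else 0.
have -> : end_fun (h x) (fun=> a) = end_fun (h x) (f + (fun n => if (`|n| <= m)%N then 0 else a)).
  congr (end_fun _ _); apply: funext => n.
  change (a = f n + (if (`|n| <= m)%N then 0 else a)).
  by rewrite /f; case: ifP; rewrite ?addr0 ?add0r.
rewrite (linear_mapD _ _ (@end_fun_lin _ _ (h x))).
change (end_fun (h x) f 0 - (end_fun (h x) f 0 +
  end_fun (h x) (fun n => if (`|n| <= m)%N then 0 else a) 0) = 0).
have -> : end_fun (h x) (fun n => if (`|n| <= m)%N then 0 else a) 0 = 0.
  by apply: hN => k le; rewrite ifT //; lia.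
by rewrite addr0 subrr.
Qed.

Lemma iter_shift w c (f : V) (b : int) m :
  (forall n : int, (n < b)%R -> f n = 0) ->
  forall n : int, (n < b + (m * size c)%:Z)%R ->
    iter m (end_fun (h (path_elt pv pe w c))) f n = 0.
Proof.
move=> f0; elim: m => [|m IHm] n ltn /=; first by apply: f0; lia.
by rewrite {1}graded_path shift_opE IHm ?nmul0r //; lia.
Qed.

(** As [x] absorbs [c], the action of [c] may be inserted [2m + 1] times on the corresponding side
    of [h x]. Each copy moves the support to the right by at least 1, in the end so far that the
    value [x ** a] at 0 vanishes. *)
Lemma fixed_mul_eq0 w c x : c <> [::] ->
  x ** path_elt pv pe w c = x \/ path_elt pv pe w c ** x = x -> forall a, x ** a = 0.
Proof.
move=> c0 xc a; have [N hN] := graded_window x a; have [N' hN'] := graded_local x.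
pose m := maxn N N'; have [<- far] := hN m (leq_maxl _ _).
set f := fun n : int => _ in far *.
have le_N'm : (N' <= m)%N by apply: leq_maxr.
have szc : (0 < size c)%N by case: (c) c0.
have lemk : (m + m < (m + m).+1 * size c)%N by apply: leq_pmulr.
pose hc := end_fun (h (path_elt pv pe w c)).
case: xc => xc.
  have -> : end_fun (h x) f = end_fun (h x) (iter (m + m).+1 hc f).
    elim: (m + m).+1 => // k {1}->; apply: funext => n.
    by rewrite -{1}xc hM.
  apply: hN' => k le; apply: (@iter_shift _ _ _ (- m%:Z)) => [n ltn|]; last by lia.
  by rewrite /f ifN //; lia.
have -> : end_fun (h x) f = iter (m + m).+1 hc (end_fun (h x) f).
  elim: (m + m).+1 => // k IHk /=; rewrite -IHk; apply: funext => n.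
  by rewrite -{1}xc hM.
by apply: (@iter_shift w c _ _ (m + m).+1 far); lia.
Qed.

End GradedMap.

(* Multiplication by a path of positive length shifts the grading. *)
Lemma path_fix_zero w c x : c <> [::] ->
  x ** path_elt pv pe w c = x \/ path_elt pv pe w c ** x = x -> x = 0.
Proof.
move=> c0 xc; have [h [hh [hv [he [hs _]]]]] := LPA.2 _ _ _ _ grading_rep.
have [u [_ <-]] := lpa_local_units LPA x.
exact: (fixed_mul_eq0 hh hv he hs c0 xc).
Qed.
End Grading.

(** * From annihilator ideals to the graph *)

Section LatticeToGraph.
Variables (E : graph) (K : fieldType) (A : nuAlg K).
Variables (pv : vert E -> A) (pe pes : edge E -> A).
Hypothesis LPA : is_leavitt_path_algebra pv pe pes.
Let LF : leavitt_family pv pe pes := LPA.1.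
Implicit Types (H : vert E -> Prop).

(** Multiplication by [p^*] reduces this to the vertex [w], which acts nontrivially on functions on
    infinite paths. *)
Lemma path_elt_neq0 u p w : walk u p w -> path_elt pv pe w p <> 0.
Proof.
move=> up p0; have [f [[_ [fZ fM]] [fv _]]] := LPA.2 _ _ _ _ (path_rep E K).
have pw0 : pv w = 0 by rewrite -(star_path LF up) p0 nmul0r.
apply: (@rep_v_neq0 E K w); rewrite -fv pw0 -(scale0r (0 : A)) fZ.
by rewrite scale0r.
Qed.

Lemma span_path H u p w : H w -> walk u p w -> span pv pe pes H (path_elt pv pe w p).
Proof.
move=> Hw up; have := @lin_term _ _ _ pv pe pes (term_into H) 1 p w [::].
rewrite scale1r /mono star_nil (path_pv LF); apply.
by split=> //; [exists u | exists w].
Qed.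

Lemma eq_sum_In (T : Type) (l : seq T) (F G : T -> A) :
  (forall t, List.In t l -> F t = G t) -> \sum_(t <- l) F t = \sum_(t <- l) G t.
Proof.
elim: l => [|t l IHl] FG; first by rewrite !big_nil.
rewrite !big_cons FG; last by left.
by rewrite IHl // => t' tl; apply: FG; right.
Qed.

(* Multiplying by [q q^*] for a shortest [q] isolates the monomials whose ghost path
   extends [q]. *)
Lemma span_annihilated_eq0 H x : span pv pe pes H x ->
  (forall y, span pv pe pes H y -> x ** y = 0) -> x = 0.
Proof.
move=> [l [lP ->]] {x} ann0.
have {}ann0 q w u : H w -> walk u q w -> (\sum_(t <- l) tval pv pe pes t) ** path_elt pv pe w q = 0.
  by move=> Hw uq; apply: ann0; apply: span_path uq.
have [n] := ubnP (size l); elim: n => // n IHn in l lP ann0 *; rewrite ltnS => szl.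
have [->|l0] := pselect (l = [::]); first by rewrite big_nil.
have [|q [[t1 [t1l t1q]] qmin]] := @ex_minimal_size _ (fun q => exists t, List.In t l /\ tq t = q).
  by case: (l) l0 => // t s _; exists (tq t), t; split=> //; left.
have [Hw _ [u uq]] := lP t1 t1l; rewrite t1q in uq.
set w := tw t1 in Hw uq.
pose B (t : term E K) := `[< exists s, tq t = q ++ s /\ walk w s (tw t) >].
have Bval t : List.In t l -> tval pv pe pes t ** path_elt pv pe w q ** star_elt pv pes w q =
    if B t then tval pv pe pes t else 0.
  move=> tl; have [_ _ [u' u'q]] := lP t tl; rewrite /tval /mono /B !numulZl -!numulA.
  case: asboolP => [[s [tqE ws]]|nB].
    by rewrite tqE [star_elt _ _ _ _ ** (_ ** _)]numulA (star_cat_path LF uq ws) (star_cat LF _ ws).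
  suff -> : star_elt pv pes (tw t) (tq t) ** (path_elt pv pe w q ** star_elt pv pes w q) = 0.
    by rewrite nmul0r scaler0.
  rewrite numulA; have [uu'|uu'] := pselect (u = u'); last first.
    rewrite -(pv_path LF uq) [star_elt _ _ _ _ ** (_ ** _)]numulA.
    by rewrite (star_pv0 LF u'q uu') !nmul0l.
  rewrite (star_path0 LF) ?nmul0l // => -[s tqE]; apply: nB; exists s.
  have {}tqE : tq t = q ++ s.
    case: tqE => // qE; have := qmin (tq t) (ex_intro _ t (conj tl erefl)).
    rewrite qE size_cat -[X in (_ <= X)%N]addn0 leq_add2l.
    by case: (s) => // _; rewrite !cats0.
  split=> //; move: u'q; rewrite -uu' tqE => /walk_cat[y [uy]].
  by rewrite (walk_end uy uq).
(* The monomials kept by the multiplication sum to zero and are dropped; [t1] is among them, so the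
   list becomes shorter. *)
have sumB : \sum_(t <- l | B t) tval pv pe pes t = 0.
  rewrite big_mkcond -(eq_sum_In Bval).
  by rewrite -!nmul_suml (ann0 q w u) // nmul0l.
have sumE : \sum_(t <- l) tval pv pe pes t =
    \sum_(t <- [seq t <- l | ~~ B t]) tval pv pe pes t.
  by rewrite (bigID B) /= sumB add0r big_filter.
rewrite sumE; apply: IHn => [t|q' w' u' Hw' uq'|].
- have -> : [seq t <- l | ~~ B t] = [seq t <- l | `[< ~ B t >]].
    by apply: eq_filter => t'; rewrite asbool_neg asboolb.
  by move=> /In_filter[tl _]; apply: lP.
- by rewrite -sumE (ann0 _ _ u').
apply: leq_trans szl; have [l1 [l2 ->]] := In_split t1l.
have B1 : B t1 by apply/asboolP; exists [::]; rewrite cats0.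
rewrite filter_cat /= B1 /= size_cat [X in (_ < X)%N]size_cat /= addnS ltnS.
by apply: leq_add; rewrite size_filter count_size.
Qed.

Hypothesis annE : forall I : A -> Prop, ideal I -> annihilator_ideal I.

(** An element annihilating [I + ann I] lies in [ann (ann I)], which is [I], and annihilates [I]; so
    it is zero by [span_annihilated_eq0]. Hence the double annihilator of [I + ann I] is
    everything. *)
Lemma span_complemented H : hereditary H ->
  forall x, isum (span pv pe pes H) (ann (span pv pe pes H)) x.
Proof.
move=> hH x; set I := span pv pe pes H.
have hI : ideal I by apply: span_ideal.
have hJ := ann_ideal hI; have hS := isum_ideal hI hJ.
apply/(annE hS) => y annSy; suff -> : y = 0 by rewrite nmul0l nmul0r.
apply: (@span_annihilated_eq0 H).
  by apply/(annE hI) => z annIz; apply: annSy; apply: isumr.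
by move=> z Iz; have [] := annSy z (isuml hJ Iz).
Qed.

(** Split [v = i + j] along the span and its annihilator; [Q] consists of the ghost paths from [v]
    in the monomials of [i]. For a path [p] from [v] to [H], [i p = p] is nonzero, so some ghost
    path in [Q] is comparable with [p]. *)
Lemma finite_comparable H v : hereditary H -> exists Q : seq (seq (edge E)),
  (forall q, List.In q Q -> exists w, H w /\ walk v q w) /\
  forall p w, H w -> walk v p w -> exists q, List.In q Q /\ comparable_words q p.
Proof.
move=> hH; have [i [j [Hi [annj vE]]]] := span_complemented hH (pv v).
have [Q [QP iQ]] : exists Q : seq (seq (edge E)),
    (forall q, List.In q Q -> exists w, H w /\ walk v q w) /\
    forall p w, walk v p w -> (forall q, List.In q Q -> ~ comparable_words q p) ->
      i ** path_elt pv pe w p = 0.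
  elim/lin_ind: i / Hi {vE} => [|[k p w q] x [/= Hw _ [u uq]] [Q [QP xQ]]].
    by exists [::]; split=> // p w _ _; rewrite nmul0l.
  have [vu|vu] := pselect (v = u); last first.
    exists Q; split=> // p' w' vp' nQ; rewrite numulDl (xQ _ _ vp' nQ) addr0.
    rewrite /tval /mono numulZl -numulA -(pv_path LF vp') /= [star_elt _ _ _ _ ** (_ ** _)]numulA.
    by rewrite (star_pv0 LF uq vu) nmul0l nmul0r scaler0.
  exists (q :: Q); split=> [q' [<-|/QP //]|p' w' vp' nQ]; first by exists w; rewrite vu.
  rewrite numulDl (xQ _ _ vp'); last by move=> q' q'Q; apply: nQ; right.
  rewrite /tval /mono numulZl -numulA /= (star_path0 LF) ?nmul0r ?scaler0 ?addr0 //.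
  by apply: nQ; left.
exists Q; split=> // p w Hw vp; apply: contrapT => nQ.
apply: (path_elt_neq0 vp); rewrite -(pv_path LF vp) vE numulDl.
rewrite (iQ p w vp) => [|q qQ qp]; last by apply: nQ; exists q.
by have [-> _] := annj _ (span_path Hw vp); rewrite addr0.
Qed.

Lemma cycle_has_exit c : is_cycle c -> has_exit (E := E) c.
Proof.
move=> cc; apply: contrapT => nexit; have [c0 [[v vc] _]] := (cycleP c).1 cc.
have [f [[fD [fZ fM]] [fv [fe _]]]] := LPA.2 _ _ _ _ (path_rep E K).
have f0 : f 0 = 0 by have := fZ 0 0; rewrite !scale0r.
have fB x y : f (x - y) = f x - f y by rewrite fD -scaleN1r fZ scaleN1r.
have hI : ideal (fun x => f x = 0).
  split=> //; split=> [x y fx fy|r x fx]; first by rewrite fB fx fy subr0.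
  by rewrite !fM fx nmul0l nmul0r.
have fpath w p : f (path_elt pv pe w p) = path_elt (@rep_v E K) (@rep_e E K) w p.
  by elim: p => [|e p IHp]; [apply: fv | rewrite path_elt_cons fM fe IHp].
have cI : f (pv v - path_elt pv pe v c) = 0.
  by rewrite fB fv fpath (rep_no_exit K cc nexit vc) subrr.
apply: (@rep_v_neq0 E K v); rewrite -fv; apply/(annE hI) => r annr.
(* As [r] annihilates [v - c], left multiplication by [c] fixes [v r] and right multiplication by
   [c] fixes [r v]; both vanish by [path_fix_zero]. *)
have [rvc vcr] := annr _ cI; move: rvc vcr.
rewrite nmulBr nmulBl => /eqP; rewrite subr_eq0 => /eqP rvc /eqP; rewrite subr_eq0 => /eqP vcr.
split.
  apply: (path_fix_zero LPA (w := v) c0); right.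
  by rewrite numulA (path_pv LF) -vcr.
apply: (path_fix_zero LPA (w := v) c0); left.
by rewrite -numulA (pv_path LF vc) -rvc.
Qed.

(** Let [H] be the set of vertices that do not reach the cycle. If a path leads from the cycle to
    [H], precede it by more turns than the length of any [q] in [Q]: a comparable [q] then ends
    within these turns, so its end in [H] reaches the cycle. *)
Lemma cycle_extreme c : is_cycle c -> extreme_cycle (E := E) c.
Proof.
move=> cc; split=> [|e p pp ce]; first exact: cycle_has_exit.
apply: contrapT => nback.
pose H x := ~ exists w, on_cycle c w /\ reaches x w.
have hH : hereditary H.
  move=> f Hf [w [cw fw]]; apply: Hf; exists w; split=> //.
  by apply: reaches_trans fw; apply: reaches_edge.
have [c' [c'0 [vc' c'P]]] := on_cycle_rot cc ce.
have [Q [QP Qcmp]] := finite_comparable (src e) hH.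
have [m mP] : exists m, forall q, List.In q Q -> (size q < m)%N.
  elim: (Q) => [|q s [m mP]]; first by exists 0%N.
  exists (maxn (size q).+1 m) => q' [<-|/mP lt]; first exact: leq_maxl.
  by rewrite leq_max lt orbT.
have ep : walk (src e) (e :: p) (rng (last e p)) by apply/walk_path.
have [q [qQ [s qE]]] := Qcmp _ _ nback (walk_trans (walk_cpow m vc') ep).
have szq := leq_trans (mP q qQ) (leq_size_cpow m c'0).
have [w [Hw vq]] := QP q qQ.
have {}qE : cpow c' m ++ e :: p = q ++ s.
  case: qE => // h; move: szq; rewrite h !size_cat; lia.
have pre : cpow c' m = q ++ take (size (cpow c' m) - size q) s.
  have := congr1 (take (size (cpow c' m))) qE.
  by rewrite take_size_cat // take_cat ltnNge ltnW.
have := walk_cpow m vc'; rewrite pre => /walk_cat[x [/(walk_end vq) <- wv]].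
apply: Hw; exists (src e); split=> //; apply/reachesP.
by exists (take (size (cpow c' m) - size q) s).
Qed.

Lemma annihilator_sar : strongly_all_reflexive E.
Proof.
split; last exact: cycle_has_exit.
split=> [c cc|]; first by right; apply: cycle_extreme.
split=> [v infv|a ha].
  apply: contrapT => ncyc.
  (* If [v] lies on no cycle, it is outside this set, so no path in [Q] is empty. Each edge at [v]
     is then the first edge of a path in [Q], and there are finitely many of these. *)
  pose H x := exists e : edge E, src e = v /\ reaches (rng e) x.
  have hH : hereditary H.
    by move=> f [e [se ef]]; exists e; split=> //; apply: reaches_trans ef (reaches_edge f).
  have [Q [QP Qcmp]] := finite_comparable v hH.
  apply: infv; exists (flatten Q) => f sf.
  have [||q [qQ [s qE]]] := Qcmp [:: f] (rng f); [|by []|].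
    by exists f; split=> //; apply: reaches_refl.
  have fq : List.In f q.
    have [w [[e [se /reachesP[p ep]]] vq]] := QP q qQ.
    case: q qE vq {qQ} => [_ /= vw|g q [[-> _]|[-> _]] _]; try by left.
    case: ncyc; apply: (@closed_walk_on_cycle _ v (e :: p)) => //=.
    by rewrite {2}vw.
  elim: (Q) qQ => //= q' Q' IH [->|/IH h]; apply/In_cat; by [left | right].
(* The edges counted in condition (c) are those from [a] into this set. A path in [Q] comparable
   with a beginning of [a] followed by such an edge [f] must contain [f], since a shorter one would
   end at a vertex that reaches [a]. *)
pose H x := ~ Rset (ipath_vert a) x.
have hH : hereditary H.
  move=> f Hf [w [aw fw]]; apply: Hf; exists w; split=> //.
  by apply: reaches_trans fw; apply: reaches_edge.
have [Q [QP Qcmp]] := finite_comparable (src (a 0%N)) hH.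
exists (flatten Q) => f [k ak] Hf.
have wk := walk_iota 0 k ha; rewrite add0n in wk.
have wf : walk (src (a 0%N)) (rcons [seq a i | i <- iota 0 k] f) (rng f).
  by rewrite -cats1; apply: walk_trans wk _; rewrite ak.
have [q [qQ qE]] := Qcmp _ _ Hf wf.
have fq : List.In f q.
  case: qE => s [->|fE]; first by apply/In_cat; left; rewrite -cats1; apply/In_cat; right; left.
  case/lastP: s fE => [|s g].
    by rewrite cats0 => <-; rewrite -cats1; apply/In_cat; right; left.
  rewrite -rcons_cat => /rcons_inj[aE _].
  have [w [Hw aq]] := QP q qQ; case: Hw; exists (src (a k)); split; first by exists k.
  move: wk; rewrite aE => /walk_cat[x [/(walk_end aq) <- xk]].
  by apply/reachesP; exists s.
elim: (Q) qQ => //= q' Q' IH [->|/IH h]; apply/In_cat; by [left | right].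
Qed.

End LatticeToGraph.

Theorem theorem3p16 (E : graph) (K : fieldType) (A : nuAlg K)
    (pv : vert E -> A) (pe pes : edge E -> A) :
  is_leavitt_path_algebra pv pe pes ->
  ((forall I : A -> Prop, ideal I -> annihilator_ideal I) <->
     strongly_all_reflexive E) /\
  (strongly_all_reflexive E <-> ideal_lattice_boolean A).
Proof.
move=> LPA.
have sar_bool := sar_boolean LPA.
have bool_ann := boolean_annihilator (lpa_local_units LPA).
have ann_sar := annihilator_sar LPA.
by split; split=> // h; [apply/bool_ann/sar_bool | apply/ann_sar/bool_ann].
Qed.
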